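(* There is an absolute constant $c>0$ such that the following holds. Let $k\geq 2$ and $n$ be integers with $k\mid n$, let $s>0$ be an integer, let $0<\varepsilon<1/2$, and let $\mathcal{G}$ be any class of Boolean functions on $n$ bits. If $C\in{\sf FORMULA}[s]\circ\mathcal{G}$ satisfies \[ \Pr_{x\sim\{0,1\}^n}\big[C(x)={\sf GIP}^k_n(x)\big]\geq \tfrac12+\varepsilon , \] then \[ s\;\geq\; c\cdot \frac{n^2}{k^2\cdot 16^k\cdot\big(R^{(k)}_{\varepsilon/(2n^2)}(\mathcal{G})+\log n\big)^2\cdot\log^2(1/\varepsilon)}. \]
   Context: A de Morgan formula is a rooted tree whose internal gates are AND, OR (fan-in 2) and NOT (fan-in 1) and whose leaves are labelled by inputs; its size is the number of leaves. For a class $\mathcal{G}$ of Boolean functions on $n$ bits, ${\sf FORMULA}[s]\circ\mathcal{G}$ is the class of functions $F(g_1(x),\dots,g_s(x))$ where $F$ is a de Morgan formula of size at most $s$ and each $g_i\in\mathcal{G}$ (applied to the whole input $x$). Generalized inner product: for $x=(x^{(1)},\dots,x^{(k)})$ with $x^{(i)}\in\{0,1\}^{n/k}$, ${\sf GIP}^k_n(x)=\sum_{j=1}^{n/k}\prod_{i=1}^k x^{(i)}_j \bmod 2$. Number-on-forehead (NOF) model: the $n$-bit input is split canonically into $k$ consecutive blocks $x^{(1)},\dots,x^{(k)}$ of $n/k$ bits; player $i$ sees all blocks except $x^{(i)}$; players communicate by writing bits on a shared blackboard. $R^{(k)}_\delta(g)$ is the minimum cost (number of bits communicated in the worst case) of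 a public-coin randomized $k$-party NOF protocol that outputs $g(x)$ with probability at least $1-\delta$ on every input $x$; $R^{(k)}_\delta(\mathcal{G})=\max_{g\in\mathcal{G}}R^{(k)}_\delta(g)$. *)

(* Defs.v *)
From Stdlib Require Import Reals List Bool Arith.
Import ListNotations.
Open Scope R_scope.

(** Inputs: an n-bit input is a [list bool] of length n. A Boolean function
    on n bits is a [list bool -> bool] (only its values on length-n lists matter). *)

Fixpoint cube (n : nat) : list (list bool) :=
  match n with
  | O => [[]]
  | S m => map (cons false) (cube m) ++ map (cons true) (cube m)
  end.

Definition prob_agree (n : nat) (f g : list bool -> bool) : R :=
  INR (length (filter (fun x => Bool.eqb (f x) (g x)) (cube n))) / 2 ^ n.

Definition gip (k n : nat) (x : list bool) : bool :=
  let m := (n / k)%nat in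
  fold_right xorb false
    (map (fun j => forallb (fun i => nth (i * m + j)%nat x false) (seq 0 k))
         (seq 0 m)).

Inductive formula : Type :=
| FVar : nat -> formula
| FNot : formula -> formula
| FAnd : formula -> formula -> formula
| FOr  : formula -> formula -> formula.

Fixpoint fsize (F : formula) : nat :=
  match F with
  | FVar _ => 1
  | FNot G => fsize G
  | FAnd G H => fsize G + fsize H
  | FOr G H => fsize G + fsize H
  end%nat.

Fixpoint feval (v : nat -> bool) (F : formula) : bool :=
  match F with
  | FVar i => v i
  | FNot G => negb (feval v G)
  | FAnd G H => feval v G && feval v H
  | FOr G H => feval v G || feval v H
  end.

Fixpoint fvars_lt (s : nat) (F : formula) : Prop :=
  match F with
  | FVar i => (i < s)%nat
  | FNot G => fvars_lt s G
  | FAnd G H => fvars_lt s G /\ fvars_lt s H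
  | FOr G H => fvars_lt s G /\ fvars_lt s H
  end.

Definition in_formula_comp (n s : nat) (G : (list bool -> bool) -> Prop)
  (C : list bool -> bool) : Prop :=
  exists (F : formula) (gs : list (list bool -> bool)),
    (fsize F <= s)%nat /\ fvars_lt s F /\ length gs = s /\
    (forall g, In g gs -> G g) /\
    (forall x, length x = n ->
       C x = feval (fun i => nth i gs (fun _ => false) x) F).

(** Deterministic k-party NOF protocol trees: at an internal node player i
    writes one bit f(x) on the blackboard (f may depend on the node, i.e. on the
    history); leaves output a bit. *)
Inductive proto : Type :=
| POut : bool -> proto
| PSpeak : nat -> (list bool -> bool) -> proto -> proto -> proto.

Fixpoint prun (p : proto) (x : list bool) : bool :=
  match p with
  | POut b => b
  | PSpeak _ f p0 p1 => if f x then prun p1 x else prun p0 x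
  end.

Fixpoint pcost (p : proto) : nat :=
  match p with
  | POut _ => 0
  | PSpeak _ _ p0 p1 => S (Nat.max (pcost p0) (pcost p1))
  end.

Definition agree_off_block (k n i : nat) (x y : list bool) : Prop :=
  forall j, (j < n)%nat ->
    ~ (i * (n / k) <= j < i * (n / k) + n / k)%nat ->
    nth j x false = nth j y false.

Fixpoint nof_valid (k n : nat) (p : proto) : Prop :=
  match p with
  | POut _ => True
  | PSpeak i f p0 p1 =>
      (i < k)%nat /\
      (forall x y, length x = n -> length y = n -> agree_off_block k n i x y ->
         f x = f y) /\
      nof_valid k n p0 /\ nof_valid k n p1
  end.

(** Public-coin randomized NOF protocol = finite probability distribution over
    deterministic NOF protocols. It has cost <= r and computes g with error
    probability <= delta on every input. *)
Definition pub_protocol_ok (k n : nat) (delta : R) (g : list bool -> bool)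
  (r : nat) (L : list (R * proto)) : Prop :=
  (forall w p, In (w, p) L -> 0 <= w /\ nof_valid k n p /\ (pcost p <= r)%nat) /\
  fold_right Rplus 0 (map fst L) = 1 /\
  (forall x, length x = n ->
     fold_right Rplus 0
       (map (fun wp => if Bool.eqb (prun (snd wp) x) (g x) then fst wp else 0) L)
     >= 1 - delta).

Definition Rk_fun_le (k n : nat) (delta : R) (g : list bool -> bool) (r : nat) : Prop :=
  exists L, pub_protocol_ok k n delta g r L.

Definition Rk_class_le (k n : nat) (delta : R) (G : (list bool -> bool) -> Prop)
  (r : nat) : Prop :=
  forall g, G g -> Rk_fun_le k n delta g r.

Definition Rk_class_eq (k n : nat) (delta : R) (G : (list bool -> bool) -> Prop)
  (r : nat) : Prop :=
  Rk_class_le k n delta G r /\ (forall r', Rk_class_le k n delta G r' -> (r <= r')%nat).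

Definition log2 (x : R) : R := ln x / ln 2.

(* Main.v *)
(** A size-[s] formula is approximated by a real combination of signs of its
    gates. By induction on AND and NOT, [f] has a dual adversary solution: scalars
    [w_x(l)], one per leaf [l], with [sum_l w_x(l)^2 <= sqrt s] and
    [sum_(l : x_l <> y_l) w_x(l) w_y(l) = 1] whenever [f x <> f y]. With
    [a^2 = 4096 sqrt s], these give orthogonal families
    [phi_x = a e0 - sum_l w_x(l) |l, x_l>] (for [f x = 1]) and
    [chi_y = e0 / a + sum_l w_y(l) |l, ~ y_l>] (for [f y = 0]). Let [M] be a
    reflection fixing the former and negating the latter, and let [D_x] be the
    diagonal reflection fixing [e0] and the [|l, x_l>]. Then [U = M D_x] fixes
    [phi_x] when [f x = 1], and [2 U e0 = a (U chi_x - chi_x)] telescopes when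
    [f x = 0]; so the [e0]-entry of the average of [U^t e0] over [O(sqrt s)] steps
    separates the two cases, and a binomial tail reduces the error to [eps / 4]
    at the price of a factor [O(log (1 / eps))] in the exponent.

    Gates are first replaced, one at a time, by deterministic protocols that lose
    at most the average error. A sign of an [r]-bit protocol is a sum of [2^r]
    cylinder functions; multiplying these out bounds the correlation of the
    approximation with GIP by its total weight times the correlation of a single
    cylinder function. The latter is at most [(1 - 4^(1-k))^(n/k)] by iterated
    Cauchy-Schwarz (Babai-Nisan-Szegedy). *)

Require Import Defs.
From Stdlib Require Import Reals List Bool Arith ZArith FinFun Lia Lra.
Import ListNotations.
Open Scope R_scope.

(** * Finite sums and products *)

Definition lsum {A : Type} (l : list A) (f : A -> R) : R :=
  fold_right Rplus 0 (map f l).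

Definition lprod {A : Type} (l : list A) (f : A -> R) : R :=
  fold_right Rmult 1 (map f l).

Lemma lsum_nil {A} (f : A -> R) : lsum [] f = 0.
Proof. reflexivity. Qed.

Lemma lsum_cons {A} (x : A) l f : lsum (x :: l) f = f x + lsum l f.
Proof. reflexivity. Qed.

Lemma lprod_cons {A} (x : A) l f : lprod (x :: l) f = f x * lprod l f.
Proof. reflexivity. Qed.

Lemma lsum_ext {A} (l : list A) f g :
  (forall x, In x l -> f x = g x) -> lsum l f = lsum l g.
Proof. intros H. unfold lsum. now rewrite (map_ext_in _ _ _ H). Qed.

Lemma lsum_app {A} (l1 l2 : list A) f : lsum (l1 ++ l2) f = lsum l1 f + lsum l2 f.
Proof.
  induction l1 as [|x l1 IH]; cbn [app]; [unfold lsum; cbn; lra|].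
  rewrite !lsum_cons, IH. lra.
Qed.

Lemma lsum_map {A B} (g : A -> B) l f : lsum (map g l) f = lsum l (fun x => f (g x)).
Proof. unfold lsum. now rewrite map_map. Qed.

Lemma lprod_map {A B} (g : A -> B) l f : lprod (map g l) f = lprod l (fun x => f (g x)).
Proof. unfold lprod. now rewrite map_map. Qed.

Lemma lsum_flat_map {A B} (g : A -> list B) l f :
  lsum (flat_map g l) f = lsum l (fun x => lsum (g x) f).
Proof.
  induction l as [|x l IH]; [reflexivity|].
  cbn [flat_map]. now rewrite lsum_app, lsum_cons, IH.
Qed.

Lemma lsum_plus {A} (l : list A) f g :
  lsum l (fun x => f x + g x) = lsum l f + lsum l g.
Proof.
  induction l as [|x l IH]; [unfold lsum; cbn; lra|].
  rewrite !lsum_cons, IH. lra.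
Qed.

Lemma lsum_scal {A} (l : list A) c f : lsum l (fun x => c * f x) = c * lsum l f.
Proof.
  induction l as [|x l IH]; [unfold lsum; cbn; lra|].
  rewrite !lsum_cons, IH. lra.
Qed.

Lemma lsum_const {A} (l : list A) c : lsum l (fun _ => c) = INR (length l) * c.
Proof.
  induction l as [|x l IH]; [unfold lsum; cbn; lra|].
  rewrite lsum_cons, IH. cbn [length]. rewrite S_INR. lra.
Qed.

Lemma lsum_swap {A B} (l : list A) (l' : list B) (f : A -> B -> R) :
  lsum l (fun x => lsum l' (fun y => f x y)) = lsum l' (fun y => lsum l (fun x => f x y)).
Proof.
  induction l as [|x l IH].
  - transitivity (lsum l' (fun _ => 0)); [rewrite lsum_const; unfold lsum; cbn; lra|].
    now apply lsum_ext.
  - rewrite lsum_cons, IH, <- lsum_plus. now apply lsum_ext.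
Qed.

Lemma lsum_mul {A B} (l : list A) (l' : list B) f g :
  lsum l f * lsum l' g = lsum l (fun x => lsum l' (fun y => f x * g y)).
Proof.
  symmetry. rewrite (lsum_ext l _ (fun x => lsum l' g * f x)).
  - rewrite lsum_scal. lra.
  - intros x _. rewrite lsum_scal. lra.
Qed.

Lemma lsum_le {A} (l : list A) f g :
  (forall x, In x l -> f x <= g x) -> lsum l f <= lsum l g.
Proof.
  induction l as [|x l IH]; intros H; [unfold lsum; cbn; lra|].
  rewrite !lsum_cons. apply Rplus_le_compat; [apply H; now left|].
  apply IH. intros y Hy. apply H. now right.
Qed.

Lemma lsum_nonneg {A} (l : list A) f : (forall x, In x l -> 0 <= f x) -> 0 <= lsum l f.
Proof.
  intros H. replace 0 with (lsum l (fun _ => 0)) by (rewrite lsum_const; lra).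
  now apply lsum_le.
Qed.

Lemma lsum_Rabs {A} (l : list A) f : Rabs (lsum l f) <= lsum l (fun x => Rabs (f x)).
Proof.
  induction l as [|x l IH]; [unfold lsum; cbn; rewrite Rabs_R0; lra|].
  rewrite !lsum_cons. eapply Rle_trans; [apply Rabs_triang|]. lra.
Qed.

Lemma lsum_term_le {A} (l : list A) f x :
  (forall y, In y l -> 0 <= f y) -> In x l -> f x <= lsum l f.
Proof.
  induction l as [|z l IH]; intros H Hx; [easy|]. rewrite lsum_cons.
  assert (0 <= f z) by (apply H; now left).
  assert (Hl : forall y, In y l -> 0 <= f y) by (intros; apply H; now right).
  destruct Hx as [->|Hx].
  - pose proof (lsum_nonneg l f Hl). lra.
  - specialize (IH Hl Hx). lra.
Qed.

Lemma lsum_single {A} (dec : forall x y : A, {x = y} + {x <> y}) (l : list A) i f :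
  NoDup l -> In i l -> lsum l (fun j => if dec j i then f j else 0) = f i.
Proof.
  induction l as [|z l IH]; intros Hn Hi; [easy|]. rewrite lsum_cons.
  inversion_clear Hn as [|? ? Hz Hl]. destruct Hi as [->|Hi].
  - destruct (dec i i) as [_|]; [|easy].
    rewrite (lsum_ext l _ (fun _ => 0)); [rewrite lsum_const; lra|].
    intros j Hj. destruct (dec j i) as [->|]; easy.
  - destruct (dec z i) as [->|]; [easy|]. rewrite IH; trivial. lra.
Qed.

(** Cauchy-Schwarz against the constant 1, read off from the nonnegative sum of
    [(L * f y - S) ^ 2]. *)
Lemma lsum_sqr_le {A} (l : list A) f :
  lsum l f ^ 2 <= INR (length l) * lsum l (fun x => f x ^ 2).
Proof.
  set (L := INR (length l)). set (S := lsum l f). set (Q := lsum l _).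
  destruct l as [|x l]; [subst L S Q; unfold lsum; cbn; lra|].
  assert (HL : 0 < L) by (subst L; apply lt_0_INR; cbn; lia).
  assert (H : 0 <= lsum (x :: l) (fun y => (L * f y - S) ^ 2)).
  { apply lsum_nonneg. intros y _. apply pow2_ge_0. }
  rewrite (lsum_ext _ _ (fun y => L ^ 2 * f y ^ 2 + (- (2 * L * S) * f y + S ^ 2))) in H
    by (intros; ring).
  rewrite !lsum_plus, !lsum_scal, lsum_const in H.
  fold Q S L in H. nra.
Qed.

Lemma lprod_mul {A} (l : list A) f g :
  lprod l (fun x => f x * g x) = lprod l f * lprod l g.
Proof.
  induction l as [|x l IH]; [unfold lprod; cbn; lra|].
  rewrite !lprod_cons, IH. ring.
Qed.

Lemma lprod_le {A} (l : list A) f g :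
  (forall x, 0 <= f x <= g x) -> 0 <= lprod l f <= lprod l g.
Proof.
  intros H. induction l as [|x l IH]; [unfold lprod; cbn; lra|].
  rewrite !lprod_cons. specialize (H x). nra.
Qed.

(** * Correlation of GIP with cylinder functions *)

Definition sgn (b : bool) : R := if b then -1 else 1.

Lemma sgn_xorb a b : sgn (xorb a b) = sgn a * sgn b.
Proof. destruct a, b; cbn; lra. Qed.

(** * Bitwise operations and character sums over the cube *)

Fixpoint map2 (f : bool -> bool -> bool) (a b : list bool) : list bool :=
  match a, b with
  | x :: a', y :: b' => f x y :: map2 f a' b'
  | _, _ => []
  end.

Lemma map2_length f a b : length a = length b -> length (map2 f a b) = length a.
Proof.
  revert b. induction a as [|x a IH]; intros [|y b] H; cbn in *; try easy.
  now rewrite IH by lia.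
Qed.

Definition parity (a : list bool) : bool := fold_right xorb false a.

Lemma cube_length m : INR (length (cube m)) = 2 ^ m.
Proof.
  induction m as [|m IH]; [cbn; lra|].
  cbn [cube]. rewrite length_app, !length_map, plus_INR, IH. cbn; lra.
Qed.

Lemma cube_spec m y : In y (cube m) <-> length y = m.
Proof.
  revert y. induction m as [|m IH]; intros y; cbn [cube].
  - destruct y; cbn; split; intros H; try easy; try (now left). now destruct H.
  - rewrite in_app_iff, !in_map_iff. split.
    + intros [[z [<- Hz]]|[z [<- Hz]]]; cbn; f_equal; now apply IH.
    + destruct y as [|[|] y]; cbn; intros H; [easy| |].
      * right. exists y. split; trivial. apply IH. lia.
      * left. exists y. split; trivial. apply IH. lia.
Qed.

Lemma lsum_cube_S m f :
  lsum (cube (S m)) f = lsum (cube m) (fun y => f (false :: y) + f (true :: y)).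
Proof. cbn [cube]. now rewrite lsum_app, !lsum_map, lsum_plus. Qed.

Lemma lsum_cube_add m n f :
  lsum (cube (m + n)) f = lsum (cube m) (fun y => lsum (cube n) (fun z => f (y ++ z))).
Proof.
  revert f. induction m as [|m IH]; intros f.
  - cbn [Nat.add cube]. rewrite lsum_cons, lsum_nil, Rplus_0_r. reflexivity.
  - cbn [Nat.add]. rewrite !lsum_cube_S, IH. apply lsum_ext. intros y _.
    now rewrite <- lsum_plus.
Qed.

(** [mask_char a [x1; ...; xk]] is the sign of the inner product of
    [a, x1, ..., xk]; carrying the mask [a] makes the statement closed under
    fixing a block. *)
Fixpoint mask_char (a : list bool) (X : list (list bool)) : R :=
  match X with
  | [] => sgn (parity a)
  | y :: X' => mask_char (map2 andb a y) X'
  end.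

(** AND distributes over XOR, so for fixed blocks the sign is a character of the mask. This merges
    the two copies of a block that squaring creates. *)
Lemma mask_char_xorb a b X :
  length a = length b -> (forall y, In y X -> length y = length a) ->
  mask_char a X * mask_char b X = mask_char (map2 xorb a b) X.
Proof.
  revert a b. induction X as [|y X IH]; intros a b Hab HX; cbn [mask_char].
  - rewrite <- sgn_xorb. f_equal. clear HX. revert b Hab.
    induction a as [|x a IH]; intros [|z b] H; cbn in *; try easy.
    rewrite <- IH by lia. fold (parity a) (parity b).
    destruct x, z, (parity a), (parity b); easy.
  - assert (Hy : length y = length a) by (apply HX; now left).
    rewrite IH.
    + f_equal. clear IH HX. revert b y Hab Hy.
      induction a as [|x a IH]; intros [|z b] [|t y] H1 H2; cbn in *; try easy.
      rewrite IH by lia. f_equal. now destruct x, z, t.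
    + rewrite !map2_length; lia.
    + intros z Hz. rewrite map2_length by lia. apply HX. now right.
Qed.

(** This is [rho] to the Hamming weight of [a]; the product form lets sums over the cube factor
    coordinate by coordinate. *)
Definition mask_weight (rho : R) (a : list bool) : R :=
  lprod a (fun b => if b then rho else 1).

(** Orthogonality of characters: the sum vanishes unless [a] is the zero mask, whose indicator is
    [mask_weight 0 a]. *)
Lemma sum_char_mask m a :
  length a = m ->
  lsum (cube m) (fun y => sgn (parity (map2 andb a y))) = 2 ^ m * mask_weight 0 a.
Proof.
  revert a. induction m as [|m IH]; intros [|x a] H; cbn in H; try easy.
  - unfold lsum, mask_weight, lprod; cbn; lra.
  - rewrite lsum_cube_S. cbn [map2 parity fold_right].
    unfold mask_weight. rewrite lprod_cons. fold (mask_weight 0 a).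
    rewrite (lsum_ext _ _ (fun y => (1 + sgn x) * sgn (parity (map2 andb a y)))).
    + rewrite lsum_scal, IH by lia. destruct x; cbn; lra.
    + intros y _. fold (parity (map2 andb a y)). rewrite !sgn_xorb.
      destruct x; cbn; lra.
Qed.

(** For independent uniform [y] and [z] every bit of their XOR is uniform, so a set coordinate of
    [a] averages 1 and [rho], while a clear one contributes 1. *)
Lemma sum_mask_weight_xorb m rho a :
  length a = m ->
  lsum (cube m) (fun y => lsum (cube m) (fun z =>
    mask_weight rho (map2 andb a (map2 xorb y z)))) =
  4 ^ m * mask_weight ((1 + rho) / 2) a.
Proof.
  revert a. induction m as [|m IH]; intros [|x a] H; cbn in H; try easy.
  - unfold lsum, mask_weight, lprod; cbn; lra.
  - rewrite lsum_cube_S.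
    rewrite (lsum_ext _ _ (fun y => (if x then 2 * (1 + rho) else 4) *
      lsum (cube m) (fun z => mask_weight rho (map2 andb a (map2 xorb y z))))).
    + rewrite lsum_scal, IH by lia. unfold mask_weight. rewrite lprod_cons.
      destruct x; cbn [pow]; field.
    + intros y _. rewrite !lsum_cube_S, <- lsum_plus, <- lsum_scal.
      apply lsum_ext. intros z _. cbn [map2]. unfold mask_weight.
      rewrite !lprod_cons. destruct x; cbn; ring.
Qed.

(** * Tuples of blocks and the Babai-Nisan-Szegedy bound *)

Fixpoint blocks (k m : nat) : list (list (list bool)) :=
  match k with
  | O => [[]]
  | S k' => flat_map (fun y => map (cons y) (blocks k' m)) (cube m)
  end.

Definition is_blocks (k m : nat) (X : list (list bool)) : Prop :=
  length X = k /\ forall y, In y X -> length y = m.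

Lemma blocks_spec k m X : In X (blocks k m) -> is_blocks k m X.
Proof.
  revert X. induction k as [|k IH]; intros X; cbn [blocks].
  - intros [<-|[]]. split; cbn; easy.
  - rewrite in_flat_map. intros [y [Hy HX]]. apply in_map_iff in HX.
    destruct HX as [Z [<- HZ]]. apply IH in HZ. destruct HZ as [H1 H2].
    split; cbn; [lia|]. intros z [<-|Hz]; [now apply cube_spec|auto].
Qed.

Lemma is_blocks_cons k m y X :
  length y = m -> is_blocks k m X -> is_blocks (S k) m (y :: X).
Proof.
  intros Hy [H1 H2]. split; cbn; [lia|]. intros z [<-|Hz]; auto.
Qed.

Lemma lsum_blocks_S k m f :
  lsum (blocks (S k) m) f = lsum (cube m) (fun y => lsum (blocks k m) (fun X => f (y :: X))).
Proof.
  cbn [blocks]. rewrite lsum_flat_map. apply lsum_ext. intros y _. now rewrite lsum_map.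
Qed.

Lemma blocks_length k m : INR (length (blocks k m)) = (2 ^ m) ^ k.
Proof.
  rewrite <- (Rmult_1_r (INR _)), <- lsum_const.
  induction k as [|k IH]; [unfold lsum; cbn; lra|].
  rewrite lsum_blocks_S, (lsum_ext _ _ (fun _ => (2 ^ m) ^ k)) by (intros; apply IH).
  rewrite lsum_const, cube_length. reflexivity.
Qed.

(** For [k+1] blocks the mask weight is [1 - 4^(-k)], since
    [(1 + (1 - q)) / 2 <= (1 - q / 4)^2]. *)
Lemma mask_weight_half q a :
  0 <= q <= 1 ->
  mask_weight ((1 + (1 - q)) / 2) a <= mask_weight (1 - q / 4) a ^ 2.
Proof.
  intros Hq. unfold mask_weight. cbn [pow]. rewrite Rmult_1_r, <- lprod_mul.
  apply lprod_le. intros []; nra.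
Qed.

Definition block_indep (k m i : nat) (f : list (list bool) -> R) : Prop :=
  forall X Y, is_blocks k m X -> is_blocks k m Y ->
    (forall j, j <> i -> nth j X [] = nth j Y []) -> f X = f Y.

(** Induction on the number of blocks. [phi 0] ignores the first block, so Cauchy-Schwarz over the
    other blocks removes it and doubles the first block into [y] and [z]. For each pair this leaves
    the same kind of sum with one block fewer and [a] masked further by the XOR of [y] and [z]. *)
Lemma gip_cylinder_bound k m a (phi : nat -> list (list bool) -> R) :
  length a = m ->
  (forall i X, Rabs (phi i X) <= 1) ->
  (forall i, (i <= k)%nat -> block_indep (S k) m i (phi i)) ->
  Rabs (lsum (blocks (S k) m)
          (fun X => mask_char a X * lprod (seq 0 (S k)) (fun i => phi i X)))
  <= (2 ^ m) ^ S k * mask_weight (1 - (/ 4) ^ k) a.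
Proof.
  revert a phi. induction k as [|k IH]; intros a phi Ha Hb Hi.
  (* Any value serves for the block that [phi 0] ignores. With a single block [phi 0] is constant
     and only a character sum is left. *)
  - set (y0 := repeat false m).
    assert (Hy0 : length y0 = m) by apply repeat_length.
    rewrite lsum_blocks_S.
    rewrite (lsum_ext _ _ (fun y => phi O [y0] * sgn (parity (map2 andb a y)))).
    + rewrite lsum_scal, sum_char_mask by trivial.
      replace (1 - (/ 4) ^ 0) with 0 by (cbn; lra).
      assert (H0 : 0 <= 2 ^ m * mask_weight 0 a).
      { apply Rmult_le_pos; [apply pow_le; lra|].
        apply (lprod_le a (fun b => if b then 0 else 1) (fun _ => 1)).
        intros []; lra. }
      rewrite Rabs_mult, (Rabs_pos_eq _ H0), pow_1. specialize (Hb O [y0]). nra.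
    + intros y Hy. apply cube_spec in Hy. cbn [blocks].
      unfold lsum, lprod; cbn. rewrite (Hi O (le_n _) [y] [y0]); [lra| | |].
      * apply is_blocks_cons; trivial. split; cbn; easy.
      * apply is_blocks_cons; trivial. split; cbn; easy.
      * intros [|[|j]] Hj; easy.
  - set (N := (2 ^ m) ^ S k).
    set (G := fun y X => mask_char (map2 andb a y) X *
                lprod (seq 0 (S k)) (fun i => phi (S i) (y :: X))).
    set (y0 := repeat false m).
    assert (Hy0 : length y0 = m) by apply repeat_length.
    rewrite lsum_blocks_S, lsum_swap.
    rewrite (lsum_ext _ _ (fun X => phi O (y0 :: X) * lsum (cube m) (fun y => G y X))).
    2:{ intros X HX. rewrite <- lsum_scal. apply lsum_ext. intros y Hy.
        apply blocks_spec in HX. apply cube_spec in Hy.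
        cbn [mask_char]. change (seq 0 (S (S k))) with (O :: seq 1 (S k)).
        rewrite lprod_cons, <- seq_shift, lprod_map.
        rewrite (Hi O ltac:(lia) (y :: X) (y0 :: X)); [unfold G; ring| | |].
        - now apply is_blocks_cons.
        - now apply is_blocks_cons.
        - intros [|j] Hj; easy. }
    set (T := lsum (blocks (S k) m) _).
    assert (HN : 0 < N) by (unfold N; repeat apply pow_lt; lra).
    set (q := (/ 4) ^ k).
    assert (Hq : 0 <= q <= 1).
    { split; [apply pow_le; lra|]. unfold q. rewrite <- (pow1 k).
      apply pow_incr. lra. }
    replace (1 - (/ 4) ^ S k) with (1 - q / 4) by (cbn; unfold q; lra).
    (* One factor [N] comes from Cauchy-Schwarz, the other from the induction hypothesis at each
       pair [y], [z]; summing the mask weights over all pairs gives the rest. *)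
    assert (HT : T ^ 2 <= N * (N * (4 ^ m * mask_weight ((1 + (1 - q)) / 2) a))).
    { eapply Rle_trans; [apply lsum_sqr_le|].
      rewrite blocks_length. fold N. apply Rmult_le_compat_l; [lra|].
      apply Rle_trans with
        (lsum (blocks (S k) m) (fun X => lsum (cube m) (fun y => G y X) ^ 2)).
      { apply lsum_le. intros X _. rewrite Rpow_mult_distr.
        pose proof (pow2_ge_0 (lsum (cube m) (fun y => G y X))).
        assert (phi O (y0 :: X) ^ 2 <= 1).
        { rewrite <- (pow2_abs (phi _ _)). specialize (Hb O (y0 :: X)).
          pose proof (Rabs_pos (phi O (y0 :: X))). nra. }
        nra. }
      rewrite (lsum_ext _ _ (fun X => lsum (cube m) (fun y => lsum (cube m) (fun z =>
                 G y X * G z X)))).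
      2:{ intros X _. rewrite <- lsum_mul. cbn; ring. }
      rewrite lsum_swap, <- sum_mask_weight_xorb, <- lsum_scal by trivial.
      apply lsum_le. intros y Hy. rewrite lsum_swap, <- lsum_scal.
      apply lsum_le. intros z Hz. apply cube_spec in Hy. apply cube_spec in Hz.
      eapply Rle_trans; [apply Rle_abs|].
      (* The new factor for block [i] is the product of the two copies of [phi (S i)], which still
         ignores that block. *)
      rewrite (lsum_ext _ _ (fun X => mask_char (map2 andb a (map2 xorb y z)) X *
        lprod (seq 0 (S k)) (fun i => phi (S i) (y :: X) * phi (S i) (z :: X)))).
      - apply IH.
        + rewrite map2_length; [trivial|]. rewrite map2_length; lia.
        + intros i X. rewrite Rabs_mult.
          pose proof (Hb (S i) (y :: X)). pose proof (Hb (S i) (z :: X)).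
          pose proof (Rabs_pos (phi (S i) (y :: X))).
          pose proof (Rabs_pos (phi (S i) (z :: X))). nra.
        + intros i Hik X Y HX HY HXY.
          f_equal; apply (Hi (S i)); try lia; try (now apply is_blocks_cons);
            (intros [|j] Hj; cbn; [reflexivity|apply HXY; lia]).
      - intros X HX. apply blocks_spec in HX. destruct HX as [_ HX].
        unfold G. rewrite lprod_mul.
        assert (E : map2 andb a (map2 xorb y z) = map2 xorb (map2 andb a y) (map2 andb a z)).
        { clear - Ha Hy Hz. subst m. revert y z Hy Hz.
          induction a as [|b a IH]; intros [|c y] [|d z] H1 H2; cbn in *; try easy.
          rewrite IH by lia. f_equal. now destruct b, c, d. }
        rewrite E, <- mask_char_xorb; [ring| |].
        + rewrite !map2_length; lia.
        + intros t Ht. rewrite map2_length by lia. rewrite Ha. auto. }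
    pose proof (mask_weight_half q a Hq) as Hw.
    assert (H4 : 4 ^ m = (2 ^ m) ^ 2).
    { rewrite <- pow_mult, Nat.mul_comm, pow_mult. f_equal. lra. }
    assert (Hr : 0 <= mask_weight (1 - q / 4) a).
    { apply (lprod_le a (fun b => if b then 1 - q / 4 else 1) (fun _ => 1)).
      intros []; lra. }
    assert (H2m : 0 < 2 ^ m) by (apply pow_lt; lra).
    change ((2 ^ m) ^ S (S k)) with (2 ^ m * N).
    (* Compare squares: [mask_weight_half] makes the bound [HT] at most the square of the claimed
       one. *)
    apply Rsqr_incr_0_var.
    + rewrite <- Rsqr_abs, !Rsqr_pow2.
      eapply Rle_trans; [apply HT|]. rewrite H4, !Rpow_mult_distr.
      apply Rle_trans with (N * (N * ((2 ^ m) ^ 2 * mask_weight (1 - q / 4) a ^ 2)));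
        [|apply Req_le; ring].
      repeat apply Rmult_le_compat_l; try lra. apply pow2_ge_0.
    + apply Rmult_le_pos; [|trivial]. nra.
Qed.

(** * From flat inputs to tuples of blocks *)

Lemma nth_concat m X i j :
  (forall y, In y X -> length y = m) -> (i < length X)%nat -> (j < m)%nat ->
  nth (i * m + j) (concat X) false = nth j (nth i X []) false.
Proof.
  revert i. induction X as [|y X IH]; intros i HX Hi Hj; cbn in Hi; [lia|].
  assert (Hy : length y = m) by (apply HX; now left).
  destruct i as [|i]; cbn [concat nth].
  - cbn. rewrite app_nth1 by lia. reflexivity.
  - rewrite app_nth2 by (cbn; lia).
    replace (S i * m + j - length y)%nat with (i * m + j)%nat by (cbn; lia).
    apply IH; try lia. intros z Hz. apply HX. now right.
Qed.

Lemma concat_length k m X : is_blocks k m X -> length (concat X) = (k * m)%nat.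
Proof.
  revert k. induction X as [|y X IH]; intros k [H1 H2]; cbn in H1; subst k; [reflexivity|].
  cbn [concat]. rewrite length_app, (H2 y) by now left.
  rewrite (IH (length X)); [cbn; lia|]. split; trivial. intros z Hz. apply H2. now right.
Qed.

Lemma lsum_cube_blocks k m f :
  lsum (cube (k * m)) f = lsum (blocks k m) (fun X => f (concat X)).
Proof.
  revert f. induction k as [|k IH]; intros f; [reflexivity|].
  cbn [Nat.mul]. rewrite lsum_cube_add, lsum_blocks_S. apply lsum_ext. intros y _.
  apply (IH (fun z => f (y ++ z))).
Qed.

Lemma nth_map2_andb a b j :
  length a = length b -> nth j (map2 andb a b) false = nth j a false && nth j b false.
Proof.
  revert b j. induction a as [|x a IH]; intros [|y b] [|j] H; cbn in *; try easy.
  apply IH. lia.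
Qed.

Lemma mask_char_spec m a X :
  length a = m -> (forall y, In y X -> length y = m) ->
  mask_char a X =
  sgn (parity (map (fun j => nth j a false &&
         forallb (fun i => nth j (nth i X []) false) (seq 0 (length X))) (seq 0 m))).
Proof.
  revert a. induction X as [|y X IH]; intros a Ha HX; cbn [mask_char].
  - f_equal. f_equal. cbn. transitivity (map (fun j => nth j a false) (seq 0 m)).
    + subst m. clear. induction a as [|x a IH]; [reflexivity|].
      cbn. rewrite <- seq_shift, map_map, <- IH. reflexivity.
    + apply map_ext. intros j. now rewrite andb_true_r.
  - assert (Hy : length y = m) by (apply HX; now left).
    rewrite IH.
    + f_equal. f_equal. apply map_ext. intros j. rewrite nth_map2_andb by lia.
      cbn [length seq forallb nth]. rewrite <- seq_shift, <- andb_assoc.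
      f_equal. f_equal. generalize (seq 0 (length X)) as l.
      induction l as [|i l IHl]; cbn; [reflexivity|]. now rewrite IHl.
    + rewrite map2_length; lia.
    + intros z Hz. apply HX. now right.
Qed.

Lemma gip_concat k m X :
  (0 < k)%nat -> is_blocks k m X ->
  sgn (gip k (k * m) (concat X)) = mask_char (repeat true m) X.
Proof.
  intros Hk [H1 H2]. rewrite (mask_char_spec m); trivial; [|apply repeat_length].
  unfold gip. rewrite (Nat.mul_comm k m), Nat.div_mul by lia.
  unfold parity. f_equal. f_equal. apply map_ext_in. intros j Hj. apply in_seq in Hj.
  rewrite nth_repeat_lt by lia. cbn [andb]. rewrite H1.
  assert (Hs : forall i, In i (seq 0 k) -> (i < k)%nat)
    by (intros i Hi; apply in_seq in Hi; lia).
  revert Hs. generalize (seq 0 k) as l. induction l as [|i l IH]; intros Hs; cbn; [reflexivity|].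
  rewrite IH by (intros; apply Hs; now right).
  assert (Hi : (i < length X)%nat) by (rewrite H1; apply Hs; now left).
  now rewrite nth_concat by (trivial; lia).
Qed.

(** The condition that [nof_valid] puts on a speaker, for real-valued functions. *)
Definition forgets_block (k n i : nat) (f : list bool -> R) : Prop :=
  forall x y, length x = n -> length y = n -> agree_off_block k n i x y -> f x = f y.

Lemma forgets_block_concat k m i f :
  (0 < k)%nat -> forgets_block k (k * m) i f ->
  block_indep k m i (fun X => f (concat X)).
Proof.
  intros Hk Hf X Y HX HY HXY. apply Hf; try now apply concat_length.
  intros j Hj. rewrite (Nat.mul_comm k m), Nat.div_mul by lia. intros Hji.
  destruct HX as [X1 X2], HY as [Y1 Y2].
  assert (Hm : m <> O) by (intros ->; lia).
  assert (Hd := Nat.div_mod_eq j m). pose proof (Nat.mod_upper_bound j m Hm) as Hmod.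
  assert (Hq : (j / m < k)%nat) by (apply Nat.Div0.div_lt_upper_bound; lia).
  (* Position [j] lies in block [j / m] at offset [j mod m], and [Hji] says that this block is not
     block [i]. *)
  replace j with (j / m * m + j mod m)%nat by lia.
  rewrite !nth_concat by (trivial; lia). rewrite HXY; [reflexivity|].
  intros E. subst i. nia.
Qed.

(** * Combinations of cylinder functions *)

(** The unit ball scaled by [M] of the norm whose unit ball is the absolutely
    convex hull of products of bounded functions, each ignoring one block; this
    norm is submultiplicative and bounds the correlation with GIP. *)
Inductive cyl_span (k n : nat) : R -> (list bool -> R) -> Prop :=
| cyl_prod (phi : nat -> list bool -> R) :
    (forall i x, Rabs (phi i x) <= 1) ->
    (forall i, (i < k)%nat -> forgets_block k n i (phi i)) ->
    cyl_span k n 1 (fun x => lprod (seq 0 k) (fun i => phi i x))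
| cyl_add M N g h :
    cyl_span k n M g -> cyl_span k n N h -> cyl_span k n (M + N) (fun x => g x + h x)
| cyl_scal c M g : cyl_span k n M g -> cyl_span k n (Rabs c * M) (fun x => c * g x)
| cyl_weaken M N g h :
    M <= N -> (forall x, g x = h x) -> cyl_span k n M g -> cyl_span k n N h.

Lemma cyl_span_nonneg k n M g : cyl_span k n M g -> 0 <= M.
Proof.
  induction 1 as [| | |]; try lra. apply Rmult_le_pos; [apply Rabs_pos|trivial].
Qed.

Lemma cyl_span_const k n c : cyl_span k n (Rabs c) (fun _ => c).
Proof.
  apply (cyl_weaken _ _ (Rabs c * 1) _
           (fun x => c * lprod (seq 0 k) (fun i => (fun _ _ => 1) i x))); [lra| |].
  - intros x. assert (E : forall l : list nat, lprod l (fun _ => 1) = 1).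
    { induction l as [|i l IH]; [reflexivity|]. rewrite lprod_cons, IH. lra. }
    cbn beta. rewrite E. lra.
  - apply cyl_scal, cyl_prod; [intros; rewrite Rabs_R1; lra|]. intros i _ x y _ _ _. reflexivity.
Qed.

(** Nested inductions expand the product bilinearly. The core case is two cylinder products, whose
    factors multiply block by block. *)
Lemma cyl_span_mul k n M N g h :
  cyl_span k n M g -> cyl_span k n N h -> cyl_span k n (M * N) (fun x => g x * h x).
Proof.
  intros Hg Hh. pose proof (cyl_span_nonneg _ _ _ _ Hg) as HM.
  pose proof (cyl_span_nonneg _ _ _ _ Hh) as HN. revert HM.
  induction Hg as [phi Hb Hi|M1 M2 g1 g2 H1 IH1 H2 IH2|c M g Hg IH|M M' g g' HMM Hgg Hg IH];
    intros HM.
  - clear HM. induction Hh as [psi Hb' Hi'|N1 N2 h1 h2 H1 IH1 H2 IH2|c N h Hh IH|N N' h h' HNN Hhh Hh IH].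
    + eapply cyl_weaken; [| |apply (cyl_prod k n (fun i x => phi i x * psi i x))]; [lra| | |].
      * intros x. apply lprod_mul.
      * intros i x. rewrite Rabs_mult. pose proof (Hb i x). pose proof (Hb' i x).
        pose proof (Rabs_pos (phi i x)). pose proof (Rabs_pos (psi i x)). nra.
      * intros i Hik x y Hx Hy Hxy. now rewrite (Hi i Hik x y), (Hi' i Hik x y).
    + eapply cyl_weaken; [| |apply cyl_add; [apply IH1|apply IH2]]; cbn beta;
        try (eapply cyl_span_nonneg; eassumption); [lra|intros; lra].
    + eapply cyl_weaken; [| |apply (cyl_scal _ _ c), IH]; cbn beta;
        try (eapply cyl_span_nonneg; eassumption); [apply Req_le; ring|intros; ring].
    + eapply cyl_weaken; [| |apply IH]; try (eapply cyl_span_nonneg; eassumption); [lra|].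
      intros x. cbn beta. now rewrite Hhh.
  - eapply cyl_weaken; [| |apply cyl_add; [apply IH1|apply IH2]]; cbn beta;
      try (eapply cyl_span_nonneg; eassumption); [lra|intros; lra].
  - eapply cyl_weaken; [| |apply (cyl_scal _ _ c), IH]; cbn beta;
      try (eapply cyl_span_nonneg; eassumption); [apply Req_le; ring|intros; ring].
  - pose proof (cyl_span_nonneg _ _ _ _ Hg) as HM0.
    eapply cyl_weaken; [| |apply IH]; trivial; [nra|]. intros x. cbn beta. now rewrite Hgg.
Qed.

Lemma cyl_span_sum {A} k n M (l : list A) (g : A -> list bool -> R) :
  (forall a, In a l -> cyl_span k n M (g a)) ->
  cyl_span k n (INR (length l) * M) (fun x => lsum l (fun a => g a x)).
Proof.
  induction l as [|a l IH]; intros H.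
  - eapply cyl_weaken; [| |apply (cyl_span_const k n 0)]; [rewrite Rabs_R0; cbn; lra|reflexivity].
  - eapply cyl_weaken;
      [| |apply cyl_add; [apply (H a); now left|apply IH; intros; apply H; now right]].
    + cbn [length]. rewrite S_INR. lra.
    + intros x. now rewrite lsum_cons.
Qed.

Lemma cyl_span_pow k n M g t :
  cyl_span k n M g -> cyl_span k n (M ^ t) (fun x => g x ^ t).
Proof.
  intros H. induction t as [|t IH]; cbn [pow].
  - rewrite <- Rabs_R1 at 1. apply cyl_span_const.
  - now apply cyl_span_mul.
Qed.

(** The cylinder product with [f] in slot [i] and 1 in all others. *)
Lemma cyl_span_factor k n i f :
  (i < k)%nat -> (forall x, Rabs (f x) <= 1) -> forgets_block k n i f ->
  cyl_span k n 1 f.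
Proof.
  intros Hi Hb Hf.
  apply (cyl_weaken k n 1 1
    (fun x => lprod (seq 0 k) (fun j => (fun j x => if j =? i then f x else 1) j x)));
    [lra| |].
  - intros x. cbn beta.
    assert (E : forall l, NoDup l -> lprod l (fun j => if j =? i then f x else 1) =
                  if in_dec Nat.eq_dec i l then f x else 1).
    { induction l as [|j l IH]; intros Hn; [reflexivity|]. inversion_clear Hn.
      rewrite lprod_cons, IH by trivial.
      destruct (Nat.eqb_spec j i) as [->|Hj], (in_dec Nat.eq_dec i l),
        (in_dec Nat.eq_dec i (_ :: l)) as [Hin|Hin]; try easy; try lra;
        exfalso; cbn in Hin; tauto. }
    rewrite E by apply seq_NoDup. destruct (in_dec _ _ _) as [|Hn]; trivial.
    exfalso. apply Hn. apply in_seq. lia.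
  - apply cyl_prod.
    + intros j x. destruct (j =? i); [apply Hb|rewrite Rabs_R1; lra].
    + intros j _ x y Hx Hy Hxy. destruct (Nat.eqb_spec j i) as [->|]; auto.
Qed.

(** At a node the sign is the sum, over the two children, of the child's sign times the indicator of
    the bit written. That indicator ignores the speaker's block, so a level at most doubles the
    weight. *)
Lemma cyl_span_proto k n p :
  nof_valid k n p -> cyl_span k n (2 ^ pcost p) (fun x => sgn (prun p x)).
Proof.
  induction p as [b|i f p0 IH0 p1 IH1]; cbn [nof_valid pcost prun pow]; intros H.
  - eapply cyl_weaken; [| |apply (cyl_span_const k n (sgn b))]; [|reflexivity].
    unfold Rabs. destruct (Rcase_abs _), b; cbn in *; lra.
  - destruct H as (Hi & Hf & H0 & H1). set (c := Nat.max (pcost p0) (pcost p1)).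
    assert (K : forall b, cyl_span k n 1 (fun x => if Bool.eqb (f x) b then 1 else 0)).
    { intros b. apply (cyl_span_factor k n i); trivial.
      - intros x. destruct (Bool.eqb _ _); rewrite ?Rabs_R1, ?Rabs_R0; lra.
      - intros x y Hx Hy Hxy. now rewrite (Hf x y). }
    eapply cyl_weaken;
      [| |apply cyl_add; [apply (cyl_span_mul k n _ _ _ _ (K false) (IH0 H0))
                        |apply (cyl_span_mul k n _ _ _ _ (K true) (IH1 H1))]].
    + pose proof (Rle_pow 2 (pcost p0) c ltac:(lra) ltac:(lia)).
      pose proof (Rle_pow 2 (pcost p1) c ltac:(lra) ltac:(lia)). lra.
    + intros x. cbn beta. destruct (f x); cbn [Bool.eqb]; lra.
Qed.

Lemma mask_weight_repeat rho m : mask_weight rho (repeat true m) = rho ^ m.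
Proof.
  unfold mask_weight. induction m as [|m IH]; [reflexivity|].
  cbn [repeat]. now rewrite lprod_cons, IH.
Qed.

(** The correlation is linear in [h], so the bound for one cylinder product, taken with the all-ones
    mask, extends to the span. *)
Lemma cyl_span_gip k m M h :
  cyl_span (S k) (S k * m) M h ->
  Rabs (lsum (cube (S k * m)) (fun x => sgn (gip (S k) (S k * m) x) * h x))
  <= M * (2 ^ (S k * m) * (1 - (/ 4) ^ k) ^ m).
Proof.
  set (n := (S k * m)%nat). set (D := 2 ^ n * _).
  induction 1 as [phi Hb Hi|M N g h Hg IHg Hh IHh|c M g Hg IH|M N g h HMN Hgh Hg IH].
  - unfold D, n. rewrite lsum_cube_blocks, Rmult_1_l.
    rewrite (lsum_ext _ _ (fun X => mask_char (repeat true m) X *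
               lprod (seq 0 (S k)) (fun i => phi i (concat X)))).
    + rewrite (Nat.mul_comm _ m), pow_mult, <- (mask_weight_repeat (1 - _) m).
      apply (gip_cylinder_bound k m _ (fun i X => phi i (concat X))); [apply repeat_length|intros; apply Hb|].
      intros i Hik. apply forgets_block_concat; [lia|]. apply Hi. lia.
    + intros X HX. apply blocks_spec in HX. now rewrite gip_concat by (lia || trivial).
  - rewrite (lsum_ext _ _ (fun x => sgn (gip (S k) n x) * g x + sgn (gip (S k) n x) * h x))
      by (intros; ring).
    rewrite lsum_plus. eapply Rle_trans; [apply Rabs_triang|]. lra.
  - rewrite (lsum_ext _ _ (fun x => c * (sgn (gip (S k) n x) * g x))) by (intros; ring).
    rewrite lsum_scal, Rabs_mult, Rmult_assoc.
    apply Rmult_le_compat_l; [apply Rabs_pos|trivial].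
  - rewrite (lsum_ext _ _ (fun x => sgn (gip (S k) n x) * g x))
      by (intros; now rewrite Hgh).
    assert (HD : 0 <= D).
    { apply Rmult_le_pos; [apply pow_le; lra|]. apply pow_le.
      pose proof (pow_incr (/ 4) 1 k ltac:(lra)) as H. rewrite pow1 in H. lra. }
    nra.
Qed.

Lemma lsum_list_prod_bool {A} (l : list A) f :
  lsum (list_prod l [false; true]) f = lsum l (fun p => f (p, false) + f (p, true)).
Proof.
  induction l as [|p l IH]; [reflexivity|].
  cbn [list_prod]. rewrite lsum_app, lsum_cons, IH, lsum_map, !lsum_cons, lsum_nil. lra.
Qed.

(** * Reflections *)

(** Vectors are functions on all of [I], but only their entries on the finite list [ix] count. *)
Definition dot {I : Type} (ix : list I) (u v : I -> R) : R := lsum ix (fun i => u i * v i).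

Definition mulmv {I : Type} (ix : list I) (M : I -> I -> R) (v : I -> R) (i : I) : R :=
  dot ix (M i) v.

Lemma dot_comm {I} (ix : list I) u v : dot ix u v = dot ix v u.
Proof. apply lsum_ext. intros; ring. Qed.

Lemma dot_ext {I} (ix : list I) u v v' :
  (forall i, In i ix -> v i = v' i) -> dot ix u v = dot ix u v'.
Proof. intros H. apply lsum_ext. intros i Hi. now rewrite H. Qed.

Lemma dot_lin {I} (ix : list I) u v w c :
  dot ix u (fun i => v i + c * w i) = dot ix u v + c * dot ix u w.
Proof. unfold dot. rewrite <- lsum_scal, <- lsum_plus. apply lsum_ext. intros; ring. Qed.

Lemma sqr_le_dot {I} (ix : list I) v i : In i ix -> v i ^ 2 <= dot ix v v.
Proof.
  intros Hi. replace (v i ^ 2) with (v i * v i) by ring.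
  apply (lsum_term_le ix (fun i => v i * v i)); trivial. intros. nra.
Qed.

(** The reflection through the span of [B], built one Householder factor at a
    time: [c] below is the component of the new vector [b] orthogonal to the
    previous ones. *)
Lemma reflection_exists {I} (dec : forall i j : I, {i = j} + {i <> j}) (ix : list I)
    (A B : list (I -> R)) :
  NoDup ix ->
  (forall a b, In a A -> In b B -> dot ix a b = 0) ->
  exists M,
    (forall u v, dot ix u (mulmv ix M v) = dot ix (mulmv ix M u) v) /\
    (forall v i, In i ix -> mulmv ix M (mulmv ix M v) i = v i) /\
    (forall a i, In a A -> In i ix -> mulmv ix M a i = a i) /\
    (forall b i, In b B -> In i ix -> mulmv ix M b i = - b i).
Proof.
  intros Hn. induction B as [|b B IH]; intros Horth.
  - exists (fun i j => if dec j i then 1 else 0).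
    assert (E : forall v i, In i ix ->
              mulmv ix (fun i j => if dec j i then 1 else 0) v i = v i).
    { intros v i Hi. rewrite <- (lsum_single dec ix i v) by trivial.
      apply lsum_ext. intros j _. destruct (dec j i); ring. }
    repeat split; try (intros; easy).
    + intros u v. rewrite (dot_comm ix _ v), (dot_ext ix u _ v), (dot_ext ix v _ u) by auto.
      apply dot_comm.
    + intros v i Hi. now rewrite !E.
    + intros a i _ Hi. now apply E.
  - destruct IH as (M & Hs & Hinv & HA & HB).
    { intros a b' Ha Hb'. apply Horth; [trivial|now right]. }
    (* The orthogonal projection of [b] onto the fixed space of the current [M]. *)
    set (c := fun i => b i / 2 + / 2 * mulmv ix M b i).
    assert (Hcdot : forall v, dot ix v c = (dot ix v b + dot ix v (mulmv ix M b)) / 2).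
    { intros v. unfold c. rewrite dot_lin.
      rewrite (dot_ext ix v (fun i => b i / 2) (fun i => 0 * b i + / 2 * b i))
        by (intros; field).
      rewrite dot_lin.
      replace (dot ix v (fun i => 0 * b i)) with 0; [field|].
      unfold dot. rewrite (lsum_ext ix _ (fun i => 0 * b i)) by (intros; ring).
      rewrite lsum_scal. ring. }
    assert (Hc : forall i, In i ix -> mulmv ix M c i = c i).
    { intros i Hi. unfold mulmv at 1. rewrite Hcdot.
      change (dot ix (M i) b) with (mulmv ix M b i).
      change (dot ix (M i) (mulmv ix M b)) with (mulmv ix M (mulmv ix M b) i).
      rewrite Hinv by trivial. unfold c. field. }
    assert (Hbb : dot ix (mulmv ix M b) (mulmv ix M b) = dot ix b b).
    { rewrite Hs, dot_comm. apply dot_ext. intros. now apply Hinv. }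
    assert (Hcb : dot ix c c = dot ix b c).
    { rewrite Hcdot, (dot_comm ix c b), (dot_comm ix c), !Hcdot, Hbb.
      rewrite (dot_comm ix (mulmv ix M b) b). field. }
    (* If [c] vanishes, [M] already negates [b]. *)
    destruct (Req_dec (dot ix c c) 0) as [H0|H0].
    + exists M. repeat split; trivial. intros b' i [<-|Hb'] Hi; [|now apply HB].
      pose proof (sqr_le_dot ix c i Hi) as Hle. rewrite H0 in Hle.
      assert (c i = 0) by (pose proof (pow2_ge_0 (c i)); nra). unfold c in *. lra.
    (* Compose [M] with the Householder reflection along [c]; since [M] fixes [c], this subtracts
       [kap] times the outer square of [c]. *)
    + set (kap := 2 / dot ix c c).
      exists (fun i j => M i j + (- kap * c i) * c j).
      assert (E : forall v i, mulmv ix (fun i j => M i j + (- kap * c i) * c j) v i =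
                    mulmv ix M v i + (- kap * dot ix c v) * c i).
      { intros v i. unfold mulmv. rewrite dot_comm, dot_lin, dot_comm, (dot_comm ix v c). ring. }
      set (M' := fun i j => M i j + _) in *.
      assert (Efun : forall u v, dot ix u (mulmv ix M' v) =
                dot ix u (mulmv ix M v) + (- kap * dot ix c v) * dot ix u c).
      { intros u v. rewrite <- dot_lin. apply dot_ext. intros; apply E. }
      assert (HcM : forall v, dot ix c (mulmv ix M v) = dot ix c v).
      { intros v. rewrite Hs, !(dot_comm ix _ v). now apply dot_ext. }
      repeat split.
      * intros u v. rewrite Efun, (dot_comm ix (mulmv ix M' u)), Efun, Hs.
        rewrite (dot_comm ix v (mulmv ix M u)), (dot_comm ix u c), (dot_comm ix v c). ring.
      * intros v i Hi. rewrite E, Efun, HcM.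
        change (mulmv ix M (mulmv ix M' v) i) with (dot ix (M i) (mulmv ix M' v)).
        rewrite Efun.
        change (dot ix (M i) (mulmv ix M v)) with (mulmv ix M (mulmv ix M v) i).
        change (dot ix (M i) c) with (mulmv ix M c i).
        rewrite Hc, Hinv by trivial. unfold kap. field. trivial.
      * intros a i Ha Hi. rewrite E, HA by trivial.
        (* By symmetry [<a, M b> = <M a, b> = <a, b> = 0]. *)
        assert (Hca : dot ix c a = 0).
        { rewrite dot_comm, Hcdot, Hs, !(dot_comm ix _ b).
          rewrite (dot_ext ix b (mulmv ix M a) a) by auto.
          rewrite (dot_comm ix b a), (Horth a b) by (trivial; now left). field. }
        rewrite Hca. ring.
      * intros b' i [<-|Hb'] Hi.
        -- rewrite E, (dot_comm ix c b), <- Hcb.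
           replace (- kap * dot ix c c) with (-2) by (unfold kap; field; trivial).
           unfold c. field.
        -- rewrite E, HB by trivial.
           (* By symmetry [<b', M b> = <M b', b> = - <b', b>], which cancels the other half of
              [c]. *)
           assert (Hcb' : dot ix c b' = 0).
           { rewrite dot_comm, Hcdot, Hs, !(dot_comm ix _ b).
             rewrite (dot_ext ix b (mulmv ix M b') (fun i => 0 * b i + -1 * b' i)).
             - rewrite dot_lin.
               replace (dot ix b (fun i => 0 * b i)) with 0; [field|].
               unfold dot. rewrite (lsum_ext ix _ (fun i => 0 * (b i * b i))) by (intros; ring).
               rewrite lsum_scal. ring.
             - intros j Hj. rewrite HB by trivial. ring. }
           rewrite Hcb'. ring.
Qed.

(** * Dual adversary solutions for formulas *)

(** A dual adversary solution of value [sqrt s] for [f], with one scalar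
    [w x p] for each of the [s] leaves [p], named by their paths from the root;
    [bit p x] is the value of leaf [p] on input [x]. *)
Definition adversary (Q : (list bool -> bool) -> Prop) (f : list bool -> bool) (s : nat) :=
  exists (L : list (list bool)) (bit : list bool -> list bool -> bool)
         (w : list bool -> list bool -> R),
    NoDup L /\ length L = s /\ (forall p, In p L -> Q (bit p)) /\
    (forall x, lsum L (fun p => w x p ^ 2) <= sqrt (INR s)) /\
    (forall x y, f x = true -> f y = false ->
       lsum L (fun p => if Bool.eqb (bit p x) (bit p y) then 0 else w x p * w y p) = 1).

Lemma adversary_ext Q f g s : (forall x, f x = g x) -> adversary Q f s -> adversary Q g s.
Proof.
  intros H (L & bit & w & H1 & H2 & H3 & H4 & H5).
  exists L, bit, w. repeat split; trivial. intros x y Hx Hy. apply H5; now rewrite H.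
Qed.

Lemma adversary_leaf (Q : (list bool -> bool) -> Prop) g : Q g -> adversary Q g 1.
Proof.
  intros Hg. exists [[]], (fun _ => g), (fun _ _ => 1).
  repeat split; unfold lsum; cbn.
  - constructor; [easy|constructor].
  - now intros.
  - intros _. rewrite sqrt_1. lra.
  - intros x y -> ->. cbn. lra.
Qed.

(** The same weights serve, as the constraint is symmetric in the two inputs. *)
Lemma adversary_neg Q f s : adversary Q f s -> adversary Q (fun x => negb (f x)) s.
Proof.
  intros (L & bit & w & H1 & H2 & H3 & H4 & H5).
  exists L, bit, w. repeat split; trivial. intros x y Hx Hy.
  rewrite negb_true_iff in Hx. rewrite negb_false_iff in Hy.
  rewrite <- (H5 y x Hy Hx). apply lsum_ext. intros p _.
  destruct (bit p x), (bit p y); cbn; ring.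
Qed.

(** If both conjuncts hold, their weights are scaled by [al] and [be]; otherwise only the first
    failing conjunct keeps its weights, divided by its factor, so the cross products still sum to 1.
    The choices [al ^ 2 = sa / t] and [be ^ 2 = sb / t] bring the norm bound to [t] in every case,
    because [sa ^ 2 + sb ^ 2 = t ^ 2]. *)
Lemma adversary_and Q f g a b :
  (0 < a)%nat -> (0 < b)%nat ->
  adversary Q f a -> adversary Q g b -> adversary Q (fun x => f x && g x) (a + b).
Proof.
  intros Ha Hb (Lf & bf & wf & F1 & F2 & F3 & F4 & F5) (Lg & bg & wg & G1 & G2 & G3 & G4 & G5).
  apply lt_0_INR in Ha, Hb.
  set (sa := sqrt (INR a)) in *. set (sb := sqrt (INR b)) in *.
  set (t := sqrt (INR (a + b))).
  assert (Hsa : 0 < sa) by now apply sqrt_lt_R0.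
  assert (Hsb : 0 < sb) by now apply sqrt_lt_R0.
  assert (Ht : 0 < t) by (apply sqrt_lt_R0; rewrite plus_INR; lra).
  assert (Et : t ^ 2 = sa ^ 2 + sb ^ 2).
  { unfold t, sa, sb. rewrite !pow2_sqrt; rewrite ?plus_INR; lra. }
  set (al := sqrt (sa / t)). set (be := sqrt (sb / t)).
  assert (Hal : 0 < al) by (apply sqrt_lt_R0, Rdiv_lt_0_compat; lra).
  assert (Hbe : 0 < be) by (apply sqrt_lt_R0, Rdiv_lt_0_compat; lra).
  assert (Eal : al ^ 2 = sa / t).
  { apply pow2_sqrt. apply Rlt_le, Rdiv_lt_0_compat; lra. }
  assert (Ebe : be ^ 2 = sb / t).
  { apply pow2_sqrt. apply Rlt_le, Rdiv_lt_0_compat; lra. }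
  (* Paths into the left subtree start with [false], those into the right one with [true]; the empty
     path never occurs. *)
  exists (map (cons false) Lf ++ map (cons true) Lg),
    (fun p => match p with
              | false :: p' => bf p' | true :: p' => bg p' | [] => fun _ => false end),
    (fun x p => match p with
      | false :: p' => if f x then (if g x then al * wf x p' else 0) else wf x p' / al
      | true :: p' => if f x then (if g x then be * wg x p' else wg x p' / be) else 0
      | [] => 0
      end).
  repeat split.
  - apply NoDup_app.
    + apply Injective_map_NoDup; trivial. intros p q E. now injection E.
    + apply Injective_map_NoDup; trivial. intros p q E. now injection E.
    + intros p Hp Hq. apply in_map_iff in Hp, Hq.
      destruct Hp as [p1 [<- _]], Hq as [p2 [E _]]. discriminate E.
  - now rewrite length_app, !length_map, F2, G2.
  - intros p Hp. rewrite in_app_iff, !in_map_iff in Hp.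
    destruct Hp as [[q [<- Hq]]|[q [<- Hq]]]; auto.
  - intros x. rewrite lsum_app, !lsum_map. fold t.
    specialize (F4 x). specialize (G4 x). fold t.
    destruct (f x), (g x).
    + rewrite (lsum_ext Lf _ (fun p => al ^ 2 * wf x p ^ 2)) by (intros; ring).
      rewrite (lsum_ext Lg _ (fun p => be ^ 2 * wg x p ^ 2)) by (intros; ring).
      rewrite !lsum_scal, Eal, Ebe.
      replace t with (sa / t * sa + sb / t * sb) at 3
        by (apply (Rmult_eq_reg_r t); [field_simplify; nra|lra]).
      apply Rplus_le_compat; apply Rmult_le_compat_l; trivial;
        apply Rlt_le, Rdiv_lt_0_compat; lra.
    + rewrite (lsum_ext Lf _ (fun p => 0)) by (intros; ring).
      rewrite (lsum_ext Lg _ (fun p => / be ^ 2 * wg x p ^ 2)) by (intros; field; lra).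
      rewrite lsum_scal, lsum_const, Ebe.
      replace t with (/ (sb / t) * sb) at 2 by (field; lra).
      rewrite Rmult_0_r, Rplus_0_l. apply Rmult_le_compat_l; trivial.
      apply Rlt_le, Rinv_0_lt_compat, Rdiv_lt_0_compat; lra.
    + rewrite (lsum_ext Lg _ (fun p => 0)) by (intros; ring).
      rewrite (lsum_ext Lf _ (fun p => / al ^ 2 * wf x p ^ 2)) by (intros; field; lra).
      rewrite lsum_scal, lsum_const, Eal.
      replace t with (/ (sa / t) * sa) at 2 by (field; lra).
      rewrite Rmult_0_r, Rplus_0_r. apply Rmult_le_compat_l; trivial.
      apply Rlt_le, Rinv_0_lt_compat, Rdiv_lt_0_compat; lra.
    + rewrite (lsum_ext Lg _ (fun p => 0)) by (intros; ring).
      rewrite (lsum_ext Lf _ (fun p => / al ^ 2 * wf x p ^ 2)) by (intros; field; lra).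
      rewrite lsum_scal, lsum_const, Eal.
      replace t with (/ (sa / t) * sa) at 2 by (field; lra).
      rewrite Rmult_0_r, Rplus_0_r. apply Rmult_le_compat_l; trivial.
      apply Rlt_le, Rinv_0_lt_compat, Rdiv_lt_0_compat; lra.
  - intros x y Hx Hy. apply andb_true_iff in Hx. destruct Hx as [Hfx Hgx].
    rewrite lsum_app, !lsum_map, Hfx, Hgx.
    destruct (f y) eqn:Hfy.
    + cbn [andb] in Hy. rewrite Hy.
      rewrite (lsum_ext Lf _ (fun p => 0))
        by (intros p _; destruct (Bool.eqb _ _); ring).
      rewrite lsum_const, Rmult_0_r, Rplus_0_l, <- (G5 x y) by trivial.
      apply lsum_ext. intros p _. destruct (Bool.eqb _ _); [ring|field; lra].
    + rewrite (lsum_ext Lg _ (fun p => 0))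
        by (intros p _; destruct (Bool.eqb _ _); ring).
      rewrite lsum_const, Rmult_0_r, Rplus_0_r, <- (F5 x y) by trivial.
      apply lsum_ext. intros p _. destruct (Bool.eqb _ _); [ring|field; lra].
Qed.

Lemma fsize_pos F : (0 < fsize F)%nat.
Proof. induction F; cbn; lia. Qed.

(** Induction on the formula, with OR reduced to AND by De Morgan; negations leave the number of
    leaves unchanged. *)
Lemma adversary_formula (Q : (list bool -> bool) -> Prop) s (h : nat -> list bool -> bool) F :
  (forall i, (i < s)%nat -> Q (h i)) -> fvars_lt s F ->
  adversary Q (fun x => feval (fun i => h i x) F) (fsize F).
Proof.
  intros HQ. induction F as [i|G IHG|G IHG H IHH|G IHG H IHH]; cbn [fvars_lt feval fsize];
    intros HF.
  - apply adversary_leaf. auto.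
  - apply (adversary_neg Q (fun x => feval (fun i => h i x) G)). auto.
  - apply (adversary_and Q (fun x => feval (fun i => h i x) G)); try apply fsize_pos; tauto.
  - apply (adversary_ext Q (fun x => negb (negb (feval (fun i => h i x) G) &&
                                          negb (feval (fun i => h i x) H)))).
    + intros x. now rewrite negb_andb, !negb_involutive.
    + apply adversary_neg, (adversary_and Q (fun x => negb (feval (fun i => h i x) G)));
        try apply fsize_pos;
        [apply (adversary_neg Q (fun x => feval (fun i => h i x) G))
        |apply (adversary_neg Q (fun x => feval (fun i => h i x) H))]; tauto.
Qed.

Lemma NoDup_list_prod_bool {A} (l : list A) : NoDup l -> NoDup (list_prod l [false; true]).
Proof.
  induction 1 as [|p l Hp Hl IH]; [constructor|].
  cbn [list_prod map app].
  constructor; [|constructor; trivial]; cbn [In]; rewrite ?in_prod_iff; intuition easy.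
Qed.

(** * The averaged walk *)

Definition diagv {I : Type} (d v : I -> R) (i : I) : R := d i * v i.

Definition walk {I : Type} (ix : list I) (M : I -> I -> R) (d : I -> R) (t : nat)
  (v : I -> R) : I -> R :=
  Nat.iter t (fun u => mulmv ix M (diagv d u)) v.

Lemma walk_lin {I} (ix : list I) M d t u v c i :
  walk ix M d (S t) (fun j => u j + c * v j) i =
  walk ix M d (S t) u i + c * walk ix M d (S t) v i.
Proof.
  revert i. induction t as [|t IH]; intros i.
  - cbn. unfold mulmv. rewrite <- dot_lin. apply dot_ext. intros j _. unfold diagv. ring.
  - change (walk ix M d (S (S t))) with
      (fun v => mulmv ix M (diagv d (walk ix M d (S t) v))). cbn beta.
    unfold mulmv. rewrite <- dot_lin. apply dot_ext. intros j _. unfold diagv.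
    rewrite IH. ring.
Qed.

(** After at least one step every entry, even one outside [ix], depends only on the start vector
    restricted to [ix]. *)
Lemma walk_ext {I} (ix : list I) M d t u v i :
  (forall j, In j ix -> u j = v j) -> walk ix M d (S t) u i = walk ix M d (S t) v i.
Proof.
  intros H. revert i. induction t as [|t IH]; intros i.
  - cbn. unfold mulmv. apply dot_ext. intros j Hj. unfold diagv. now rewrite H.
  - change (walk ix M d (S (S t))) with
      (fun v => mulmv ix M (diagv d (walk ix M d (S t) v))). cbn beta.
    unfold mulmv. apply dot_ext. intros j Hj. unfold diagv. now rewrite IH.
Qed.

Lemma walk_succ_r {I} (ix : list I) M d t v :
  walk ix M d (S t) v = walk ix M d t (mulmv ix M (diagv d v)).
Proof. unfold walk. now rewrite Nat.iter_succ_r. Qed.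

(** A symmetric involution is orthogonal, and so is a diagonal of signs. *)
Lemma walk_isometry {I} (ix : list I) M d t v :
  (forall u w, dot ix u (mulmv ix M w) = dot ix (mulmv ix M u) w) ->
  (forall u i, In i ix -> mulmv ix M (mulmv ix M u) i = u i) ->
  (forall i, d i ^ 2 = 1) ->
  dot ix (walk ix M d t v) (walk ix M d t v) = dot ix v v.
Proof.
  intros Hs Hi Hd. induction t as [|t IH]; [reflexivity|].
  change (walk ix M d (S t) v) with (mulmv ix M (diagv d (walk ix M d t v))).
  rewrite Hs, dot_comm.
  rewrite (dot_ext ix _ _ (diagv d (walk ix M d t v))) by (intros; now apply Hi).
  rewrite <- IH. apply lsum_ext. intros i _. unfold diagv.
  transitivity (d i ^ 2 * (walk ix M d t v i * walk ix M d t v i)); [ring|].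
  rewrite Hd. ring.
Qed.

(** [M i j] is an entry of the image of a unit vector under an isometry. *)
Lemma reflection_entry_le1 {I} (dec : forall i j : I, {i = j} + {i <> j}) (ix : list I) M i j :
  NoDup ix ->
  (forall u w, dot ix u (mulmv ix M w) = dot ix (mulmv ix M u) w) ->
  (forall u k, In k ix -> mulmv ix M (mulmv ix M u) k = u k) ->
  In i ix -> In j ix -> Rabs (M i j) <= 1.
Proof.
  intros Hn Hs Hinv Hi Hj. set (e := fun k => if dec k j then 1 else 0).
  assert (E : forall v, dot ix v e = v j).
  { intros v. rewrite <- (lsum_single dec ix j v) by trivial. apply lsum_ext.
    intros k _. unfold e. destruct (dec k j); ring. }
  assert (H : M i j ^ 2 <= 1).
  { rewrite <- (E (M i)). change (dot ix (M i) e) with (mulmv ix M e i).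
    eapply Rle_trans; [apply (sqr_le_dot ix _ i Hi)|]. rewrite Hs.
    rewrite dot_comm, (dot_ext ix e _ e) by auto. rewrite E. unfold e.
    destruct (dec j j); lra. }
  rewrite <- pow2_abs in H. pose proof (Rabs_pos (M i j)). nra.
Qed.

(** Only [d] depends on the input. A step sums [length ix] terms, each multiplying a previous entry
    by a diagonal entry of weight [c] and a scalar of size at most 1. *)
Lemma cyl_span_walk {I} k n c (ix : list I) M (d : list bool -> I -> R) v t i :
  (forall i j, In i ix -> In j ix -> Rabs (M i j) <= 1) ->
  (forall j, In j ix -> cyl_span k n c (fun x => d x j)) ->
  (forall j, Rabs (v j) <= 1) ->
  In i ix ->
  cyl_span k n ((INR (length ix) * c) ^ t) (fun x => walk ix M (d x) t v i).
Proof.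
  intros HM Hd Hv. revert i. induction t as [|t IH]; intros i Hi.
  - eapply cyl_weaken; [| |apply (cyl_span_const k n (v i))]; [apply Hv|reflexivity].
  - cbn [pow]. rewrite Rmult_assoc.
    apply (cyl_weaken k n (INR (length ix) * (c * (INR (length ix) * c) ^ t)) _
             (fun x => lsum ix (fun j => M i j * (d x j * walk ix M (d x) t v j))));
      [lra|reflexivity|].
    apply cyl_span_sum. intros j Hj.
    pose proof (cyl_span_mul k n _ _ _ _ (Hd j Hj) (IH j Hj)) as H.
    eapply cyl_weaken; [| |apply cyl_scal, H]; [|reflexivity].
    pose proof (cyl_span_nonneg _ _ _ _ H). pose proof (HM i j Hi Hj).
    pose proof (Rabs_pos (M i j)). nra.
Qed.

(** The averages [(1/T) sum_{t=1..T} U^t e0] of the walk [U = M D_x] tell apart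
    an invariant vector close to [e0] (when [f x = true]) from a vector [chi]
    with [2 U e0 = a (U chi - chi)] (when [f x = false]), for which the average
    telescopes. *)
Lemma adversary_approx k n (Q : (list bool -> bool) -> Prop) f s c T (V : list (list bool)) :
  (forall b, Q b -> cyl_span k n c (fun x => sgn (b x))) -> 1 <= c ->
  adversary Q f s -> (0 < s)%nat -> 260 * sqrt (INR s) <= INR T ->
  exists p, cyl_span k n (((1 + 2 * INR s) * c) ^ T) p /\
    forall x, In x V ->
      p x ^ 2 <= 1 /\
      (f x = true -> 15 / 16 <= p x ^ 2) /\ (f x = false -> p x ^ 2 <= 1 / 16).
Proof.
  intros HQ Hc (L & bit & w & HL & Hlen & Hbit & Hw & Hadv) Hs HT.
  set (W := sqrt (INR s)) in *.
  assert (HsR : 1 <= INR s) by (change 1 with (INR 1); apply le_INR; lia).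
  assert (HW : 1 <= W) by (unfold W; rewrite <- sqrt_1; now apply sqrt_le_1_alt).
  (* With [a ^ 2 = 4096 * W] the part of [e0] outside [phi x / a] has norm at most [1 / 64]. *)
  set (a := 64 * sqrt W).
  assert (Ha2 : a ^ 2 = 4096 * W).
  { unfold a. rewrite Rpow_mult_distr, pow2_sqrt; lra. }
  assert (Ha : 0 < a) by (unfold a; pose proof (sqrt_lt_R0 W); lra).
  (* [None] indexes [e0], and [Some (p, b)] the basis vector for leaf [p] with value [b]. *)
  set (ix := None :: map Some (list_prod L [false; true])).
  assert (dec : forall i j : option (list bool * bool), {i = j} + {i <> j})
    by (repeat decide equality).
  assert (Hix : NoDup ix).
  { constructor.
    - rewrite in_map_iff. intros [z [E _]]. discriminate E.
    - apply Injective_map_NoDup; [intros u v E; now injection E|].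
      now apply NoDup_list_prod_bool. }
  assert (Hlix : INR (length ix) = 1 + 2 * INR s).
  { unfold ix. cbn [length]. rewrite S_INR, length_map, length_prod, Hlen, mult_INR.
    cbn. lra. }
  assert (Hsum : forall F : option (list bool * bool) -> R, lsum ix F =
            F None + lsum L (fun p => F (Some (p, false)) + F (Some (p, true)))).
  { intros F. unfold ix. now rewrite lsum_cons, lsum_map, lsum_list_prod_bool. }
  set (d := fun x (i : option (list bool * bool)) => match i with
              | None => 1 | Some (p, b) => if Bool.eqb b (bit p x) then 1 else -1 end).
  set (phi := fun x (i : option (list bool * bool)) => match i with
              | None => a | Some (p, b) => if Bool.eqb b (bit p x) then - w x p else 0 end).
  set (chi := fun x (i : option (list bool * bool)) => match i with
              | None => / a | Some (p, b) => if Bool.eqb b (bit p x) then 0 else w x p end).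
  set (e0 := fun i : option (list bool * bool) => match i with None => 1 | _ => 0 end).
  (* The [e0] entries contribute [a * / a = 1], and the leaves contribute minus the adversary sum,
     which is also 1. *)
  assert (Horth : forall u v,
      In u (map phi (filter f V)) -> In v (map chi (filter (fun x => negb (f x)) V)) ->
      dot ix u v = 0).
  { intros u v Hu Hv. apply in_map_iff in Hu, Hv.
    destruct Hu as [x [<- Hx]], Hv as [y [<- Hy]].
    apply filter_In in Hx, Hy. destruct Hx as [_ Hx], Hy as [_ Hy].
    apply negb_true_iff in Hy. unfold dot. rewrite Hsum. cbn [phi chi].
    rewrite (lsum_ext L _ (fun p => -1 *
      (if Bool.eqb (bit p x) (bit p y) then 0 else w x p * w y p))).
    - rewrite lsum_scal, Hadv by trivial. field. lra.
    - intros p _. destruct (bit p x), (bit p y); cbn; ring. }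
  destruct (reflection_exists dec ix _ _ Hix Horth) as (M & Hsym & Hinv & Hphi & Hchi).
  assert (Hd : forall x i, d x i ^ 2 = 1).
  { intros x [[p b]|]; cbn [d]; [destruct (Bool.eqb _ _)|]; ring. }
  assert (Hnone : In None ix) by (left; reflexivity).
  assert (Hcomp : forall x t v, walk ix M (d x) t v None ^ 2 <= dot ix v v).
  { intros x t v. rewrite <- (walk_isometry ix M (d x) t v); auto.
    now apply sqr_le_dot. }
  assert (HT1 : 1 <= INR T) by lra.
  exists (fun x => / INR T * lsum (seq 1 T) (fun t => walk ix M (d x) t e0 None)).
  split.
  - set (B := (1 + 2 * INR s) * c). assert (HB : 1 <= B) by (unfold B; nra).
    eapply cyl_weaken; [| |apply (cyl_scal k n (/ INR T)), (cyl_span_sum k n (B ^ T) (seq 1 T)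
        (fun t x => walk ix M (d x) t e0 None))]; [|reflexivity|].
    + rewrite length_seq, Rabs_pos_eq by (apply Rlt_le, Rinv_0_lt_compat; lra).
      right. field. lra.
    + intros t Ht. apply in_seq in Ht.
      eapply cyl_weaken; [apply (Rle_pow B t T); [trivial|lia]|reflexivity|].
      unfold B. rewrite <- Hlix. apply cyl_span_walk; trivial.
      * intros i j. now apply (reflection_entry_le1 dec).
      * intros [[p b]|] Hp; cbn [d].
        -- destruct Hp as [Hp|Hp]; [easy|]. apply in_map_iff in Hp.
           destruct Hp as [q [Eq Hp]]. injection Eq as ->. apply in_prod_iff in Hp.
           pose proof (HQ _ (Hbit p (proj1 Hp))) as HK.
           (* As [sgn true = -1], the diagonal entry is minus the sign of the leaf for [b = true]
              and the sign itself for [b = false]. *)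
           destruct b.
           ++ eapply cyl_weaken; [| |apply (cyl_scal k n (-1)), HK].
              ** replace (Rabs (-1)) with 1; [lra|]. rewrite Rabs_left; lra.
              ** intros x. cbn beta. destruct (bit p x); cbn; ring.
           ++ eapply cyl_weaken; [| |exact HK]; [lra|].
              intros x. cbn beta. now destruct (bit p x).
        -- eapply cyl_weaken; [| |apply (cyl_span_const k n 1)]; [rewrite Rabs_R1; lra|].
           reflexivity.
      * intros [?|]; cbn; rewrite ?Rabs_R0, ?Rabs_R1; lra.
  - intros x Hx.
    set (A := lsum (seq 1 T) (fun t => walk ix M (d x) t e0 None)).
    assert (Habs : Rabs A <= INR T).
    { unfold A. eapply Rle_trans; [apply lsum_Rabs|].
      replace (INR T) with (lsum (seq 1 T) (fun _ => 1))
        by (rewrite lsum_const, length_seq; ring).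
      apply lsum_le. intros t _. pose proof (Hcomp x t e0) as H.
      unfold dot in H. rewrite Hsum in H. cbn [e0] in H.
      rewrite (lsum_ext L _ (fun _ => 0)) in H by (intros; ring).
      rewrite lsum_const in H. apply Rabs_le. nra. }
    assert (Hp2 : (/ INR T * A) ^ 2 * INR T ^ 2 = A ^ 2) by (field; lra).
    assert (HT2 : 0 < INR T ^ 2) by (apply pow_lt; lra).
    repeat split.
    + assert (A ^ 2 <= INR T ^ 2).
      { rewrite <- (pow2_abs A). apply pow_incr. split; [apply Rabs_pos|trivial]. }
      nra.
    + intros Hf.
      (* The support of [phi x] lies where [d x] is 1, so both reflections fix it. *)
      assert (Hfix : forall t i, In i ix -> walk ix M (d x) t (phi x) i = phi x i).
      { induction t as [|t IH]; intros i Hi; [reflexivity|].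
        rewrite <- (Hphi (phi x) i) by (trivial; apply in_map, filter_In; now split).
        apply dot_ext. intros j Hj.
        change (d x j * walk ix M (d x) t (phi x) j = phi x j). rewrite IH by trivial.
        destruct j as [[p b]|]; cbn [d phi]; [destruct (Bool.eqb _ _)|]; ring. }
      (* The remainder in [e0 = phi x / a + eta]. *)
      set (eta := fun i : option (list bool * bool) => match i with
        | None => 0 | Some (p, b) => if Bool.eqb b (bit p x) then w x p / a else 0 end).
      assert (Heta : dot ix eta eta <= (1 / 64) ^ 2).
      { unfold dot. rewrite Hsum. cbn [eta].
        rewrite (lsum_ext L _ (fun p => / a ^ 2 * w x p ^ 2))
          by (intros p _; destruct (bit p x); cbn; field; lra).
        rewrite lsum_scal, Ha2.
        apply Rle_trans with (0 * 0 + / (4096 * W) * W); [|right; field; lra].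
        apply Rplus_le_compat_l, Rmult_le_compat_l; [|apply Hw].
        apply Rlt_le, Rinv_0_lt_compat; lra. }
      assert (HA : 63 / 64 * INR T <= A).
      { replace (63 / 64 * INR T) with (lsum (seq 1 T) (fun _ => 63 / 64))
          by (rewrite lsum_const, length_seq; ring).
        apply lsum_le. intros [|t] Ht; [apply in_seq in Ht; lia|].
        rewrite (walk_ext ix M (d x) t e0 (fun i => eta i + / a * phi x i)).
        - rewrite walk_lin, Hfix by trivial. cbn [phi].
          pose proof (Hcomp x (S t) eta). rewrite Rinv_l by lra.
          set (z := walk _ _ _ _ _ _) in *. nra.
        - intros [[p b]|] _; cbn [e0 eta phi]; [destruct (Bool.eqb _ _)|]; field; lra. }
      assert ((63 / 64 * INR T) ^ 2 <= A ^ 2) by (apply pow_incr; lra).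
      nra.
    + intros Hf.
      (* The diagonal negates [chi x] except at [e0], so adding [chi x] to its image leaves
         [2 / a * e0]; then [M] is applied, which negates [chi x]. *)
      assert (Hstep : forall i, In i ix ->
                walk ix M (d x) 1 (chi x) i = chi x i + 2 / a * walk ix M (d x) 1 e0 i).
      { intros i Hi.
        assert (Hneg : mulmv ix M (chi x) i = - chi x i).
        { apply Hchi; trivial. apply in_map, filter_In. split; trivial. now rewrite Hf. }
        change (mulmv ix M (diagv (d x) (chi x)) i =
                chi x i + 2 / a * mulmv ix M (diagv (d x) e0) i).
        unfold mulmv in Hneg |- *.
        rewrite (dot_ext ix (M i) (diagv (d x) (chi x))
                   (fun j => (diagv (d x) (chi x) j + chi x j) + -1 * chi x j))
          by (intros; ring).
        rewrite dot_lin, Hneg.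
        rewrite (dot_ext ix (M i) (fun j => diagv (d x) (chi x) j + chi x j)
                   (fun j => 0 * chi x j + 2 / a * diagv (d x) e0 j)).
        - rewrite dot_lin.
          rewrite (dot_ext ix (M i) (fun j => 0 * chi x j) (fun j => chi x j + -1 * chi x j))
            by (intros; ring).
          rewrite dot_lin. ring.
        - intros [[p b]|] _; unfold diagv; cbn [d chi e0]; [destruct (Bool.eqb _ _); ring|].
          field. lra. }
      assert (Htel : forall t, lsum (seq 1 t) (fun t => walk ix M (d x) t e0 None) =
                a / 2 * (walk ix M (d x) t (chi x) None - chi x None)).
      { induction t as [|t IH]; [unfold lsum; cbn; ring|].
        rewrite seq_S, lsum_app, lsum_cons, lsum_nil, IH. cbn [Nat.add].
        assert (E : walk ix M (d x) (S t) (chi x) None =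
                  walk ix M (d x) t (chi x) None + 2 / a * walk ix M (d x) (S t) e0 None).
        { destruct t as [|t]; [now apply Hstep|].
          rewrite !(walk_succ_r ix M (d x) (S t)), <- walk_lin.
          apply walk_ext. exact Hstep. }
        rewrite E. field. lra. }
      assert (Hdot : a ^ 2 * dot ix (chi x) (chi x) <= 4097 * W ^ 2).
      { unfold dot. rewrite Hsum. cbn [chi].
        rewrite (lsum_ext L _ (fun p => w x p ^ 2))
          by (intros p _; destruct (bit p x); cbn; ring).
        specialize (Hw x). replace (a ^ 2 * (/ a * / a + lsum L (fun p => w x p ^ 2)))
          with (1 + a ^ 2 * lsum L (fun p => w x p ^ 2)) by (field; lra).
        rewrite Ha2. nra. }
      pose proof (Hcomp x T (chi x)) as H1. pose proof (Hcomp x O (chi x)) as H2.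
      change (walk ix M (d x) 0 (chi x) None) with (chi x None) in H2.
      unfold A in Hp2 |- *. rewrite Htel in Hp2 |- *.
      set (u := walk ix M (d x) T (chi x) None) in *.
      set (v := chi x None) in *. set (D := dot ix (chi x) (chi x)) in *.
      (* From [(u - v) ^ 2 <= 2 * u ^ 2 + 2 * v ^ 2]. *)
      assert (Huv : (u - v) ^ 2 <= 4 * D) by nra.
      assert (HA2 : (a / 2 * (u - v)) ^ 2 <= 4097 * W ^ 2).
      { rewrite Rpow_mult_distr. apply Rle_trans with (a ^ 2 * D); [|trivial].
        replace ((a / 2) ^ 2) with (a ^ 2 / 4) by field.
        pose proof (pow2_ge_0 a). nra. }
      (* Here 260 suffices because [16 * 4097 <= 260 ^ 2]. *)
      assert ((260 * W) ^ 2 <= INR T ^ 2) by (apply pow_incr; lra).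
      nra.
Qed.

(** * Error reduction *)

(** [amplify m j z] is the probability of at least [j] heads in [m] tosses of a
    coin with bias [z], as a polynomial in [z]. *)
Fixpoint amplify (m j : nat) (z : R) : R :=
  match m, j with
  | _, O => 1
  | O, S _ => 0
  | S m', S j' => z * amplify m' j' z + (1 - z) * amplify m' (S j') z
  end.

Lemma amplify_bound m j z : 0 <= z <= 1 -> 0 <= amplify m j z <= 1.
Proof.
  intros Hz. revert j. induction m as [|m IH]; intros [|j]; cbn [amplify]; try lra.
  pose proof (IH j). pose proof (IH (S j)). nra.
Qed.

(** A union bound over the at most [2 ^ m] sets of tosses that could supply the heads. *)
Lemma amplify_le m j z : 0 <= z <= 1 -> amplify m j z <= 2 ^ m * z ^ j.
Proof.
  intros Hz. revert j. induction m as [|m IH]; intros [|j]; cbn [amplify].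
  - cbn; lra.
  - assert (0 <= z ^ S j) by (apply pow_le; lra). rewrite pow_O. lra.
  - pose proof (pow_R1_Rle 2 (S m)). rewrite pow_O. lra.
  - pose proof (IH j) as H1. pose proof (IH (S j)) as H2.
    pose proof (amplify_bound m (S j) z Hz). cbn [pow] in *. nra.
Qed.

(** The mirror image: fewer than [j] heads means at least [S m - j] tails. *)
Lemma amplify_ge m j z :
  0 <= z <= 1 -> (j <= S m)%nat -> 1 - amplify m j z <= 2 ^ m * (1 - z) ^ (S m - j).
Proof.
  intros Hz. revert j. induction m as [|m IH]; intros j Hj.
  - destruct j as [|j]; cbn [amplify]; [cbn; lra|].
    replace j with O by lia. cbn; lra.
  - assert (Hp : 0 <= (1 - z) ^ (S (S m) - j)) by (apply pow_le; lra).
    pose proof (pow_R1_Rle 2 (S m)) as Hp2. destruct j as [|j]; cbn [amplify]; [nra|].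
    destruct (Nat.eq_dec j (S m)) as [->|Hne].
    + replace (S (S m) - S (S m))%nat with O by lia.
      pose proof (amplify_bound m (S m) z Hz). pose proof (amplify_bound m (S (S m)) z Hz).
      rewrite pow_O. nra.
    + pose proof (IH j ltac:(lia)) as H1. pose proof (IH (S j) ltac:(lia)) as H2.
      replace (S (S m) - S j)%nat with (S (S m - S j)) by lia.
      replace (S m - j)%nat with (S (S m - S j)) in H1 by lia.
      pose proof (amplify_bound m j z Hz). pose proof (amplify_bound m (S j) z Hz).
      cbn [pow] in *. nra.
Qed.

(** A toss costs a factor [B + (1 + B)], the weights of [z] and [1 - z]. *)
Lemma cyl_span_amplify k n B z m j :
  cyl_span k n B z -> cyl_span k n ((2 * B + 1) ^ m) (fun x => amplify m j (z x)).
Proof.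
  intros Hz. pose proof (cyl_span_nonneg _ _ _ _ Hz) as HB.
  assert (H1 : cyl_span k n 1 (fun _ => 1)) by (rewrite <- Rabs_R1 at 1; apply cyl_span_const).
  assert (Hz' : cyl_span k n (1 + B) (fun x => 1 - z x)).
  { eapply cyl_weaken; [| |apply cyl_add; [exact H1|apply (cyl_scal k n (-1)), Hz]].
    - rewrite Rabs_left by lra. lra.
    - intros x. cbn beta. ring. }
  revert j. induction m as [|m IH]; intros [|j]; cbn [amplify].
  - exact H1.
  - eapply cyl_weaken; [| |apply (cyl_span_const k n 0)]; [rewrite Rabs_R0; cbn; lra|reflexivity].
  - apply (cyl_weaken k n 1 _ (fun _ => 1)); trivial. apply pow_R1_Rle. lra.
  - eapply cyl_weaken; [| |apply cyl_add; [apply (cyl_span_mul k n _ _ _ _ Hz (IH j))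
                                         |apply (cyl_span_mul k n _ _ _ _ Hz' (IH (S j)))]].
    + cbn [pow]. right. ring.
    + reflexivity.
Qed.

(** Take [2 * h] tosses with threshold [h] and bias [p x ^ 2]; either tail is at most
    [4 ^ h * (1 / 16) ^ h]. *)
Lemma adversary_approx_amplified k n (Q : (list bool -> bool) -> Prop) f s c T h
    (V : list (list bool)) :
  (forall b, Q b -> cyl_span k n c (fun x => sgn (b x))) -> 1 <= c ->
  adversary Q f s -> (0 < s)%nat -> 260 * sqrt (INR s) <= INR T ->
  exists p, cyl_span k n ((2 * (((1 + 2 * INR s) * c) ^ T) ^ 2 + 1) ^ (2 * h)) p /\
    forall x, In x V -> Rabs (p x - (if f x then 1 else 0)) <= (1 / 4) ^ h.
Proof.
  intros HQ Hc Hadv Hs HT.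
  destruct (adversary_approx k n Q f s c T V HQ Hc Hadv Hs HT) as (p & Hp & HV).
  exists (fun x => amplify (2 * h) h (p x ^ 2)). split.
  - apply cyl_span_amplify, cyl_span_pow, Hp.
  - intros x Hx. destruct (HV x Hx) as (H1 & Ht & Hf).
    assert (Hz : 0 <= p x ^ 2 <= 1) by (split; [apply pow2_ge_0|trivial]).
    pose proof (amplify_bound (2 * h) h _ Hz).
    assert (E : forall y, y <= 1 / 16 -> 0 <= y -> 2 ^ (2 * h) * y ^ h <= (1 / 4) ^ h).
    { intros y Hy Hy0. rewrite pow_mult, <- Rpow_mult_distr. apply pow_incr. lra. }
    destruct (f x).
    + pose proof (amplify_ge (2 * h) h _ Hz ltac:(lia)) as H2.
      replace (S (2 * h) - h)%nat with (S h) in H2 by lia. cbn [pow] in H2.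
      specialize (Ht eq_refl). pose proof (E (1 - p x ^ 2) ltac:(lra) ltac:(lra)) as H3.
      assert (0 <= 2 ^ (2 * h) * (1 - p x ^ 2) ^ h)
        by (apply Rmult_le_pos; apply pow_le; lra).
      rewrite Rabs_left1 by lra. cbn [pow] in *. nra.
    + pose proof (amplify_le (2 * h) h _ Hz) as H2. specialize (Hf eq_refl).
      pose proof (E (p x ^ 2) ltac:(lra) ltac:(lra)) as H3.
      rewrite Rabs_pos_eq; lra.
Qed.

(** * Derandomizing the gates *)

Lemma list_argmax {A} (l : list A) (f : A -> R) :
  l <> [] -> exists x, In x l /\ forall y, In y l -> f y <= f x.
Proof.
  induction l as [|a l IH]; intros H; [easy|]. destruct l as [|b l].
  - exists a. split; [now left|]. intros y [<-|[]]. lra.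
  - destruct IH as (x & Hx & Hm); [easy|]. destruct (Rle_dec (f x) (f a)).
    + exists a. split; [now left|]. intros y [<-|Hy]; [lra|]. specialize (Hm y Hy). lra.
    + exists x. split; [now right|]. intros y [<-|Hy]; [lra|auto].
Qed.

(** A random protocol loses at most [delta] per input in expectation, as [Psi] lies in [[0, 1]]; the
    best one in the list does at least as well as the average. *)
Lemma fix_protocol k n r delta g (Psi : list bool -> bool -> R) :
  0 <= delta -> (forall x b, 0 <= Psi x b <= 1) -> Rk_fun_le k n delta g r ->
  exists p, nof_valid k n p /\ (pcost p <= r)%nat /\
    lsum (cube n) (fun x => Psi x (g x)) - delta * 2 ^ n <=
    lsum (cube n) (fun x => Psi x (prun p x)).
Proof.
  intros Hd HPsi (L & Hok & Hsum & Hg).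
  change (lsum L fst = 1) in Hsum.
  destruct (list_argmax L (fun wp => lsum (cube n) (fun x => Psi x (prun (snd wp) x))))
    as ([w p] & Hin & Hmax).
  { intros ->. unfold lsum in Hsum. cbn in Hsum. lra. }
  exists p. destruct (Hok w p Hin) as (_ & Hv & Hcost). repeat split; trivial.
  set (mx := lsum (cube n) (fun x => Psi x (prun p x))).
  (* The weights sum to 1, so the maximum can be compared with the average term by term. *)
  replace mx with (lsum L (fun wp => mx * fst wp)) by (rewrite lsum_scal, Hsum; ring).
  apply Rle_trans with (lsum L (fun wp =>
    lsum (cube n) (fun x => fst wp * Psi x (prun (snd wp) x)))).
  - rewrite lsum_swap, <- cube_length.
    replace (delta * INR (length (cube n))) with (lsum (cube n) (fun _ => delta))
      by (rewrite lsum_const; ring).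
    replace (lsum (cube n) (fun x => Psi x (g x)) - lsum (cube n) (fun _ => delta))
      with (lsum (cube n) (fun x => Psi x (g x) + -1 * delta))
      by (rewrite lsum_plus, lsum_scal; ring).
    apply lsum_le. intros x Hx. apply cube_spec in Hx. specialize (Hg x Hx).
    apply Rle_trans with (Psi x (g x) *
      lsum L (fun wp => if Bool.eqb (prun (snd wp) x) (g x) then fst wp else 0)).
    + change (fold_right Rplus 0 (map ?f L)) with (lsum L f) in Hg.
      pose proof (HPsi x (g x)). nra.
    + rewrite <- lsum_scal. apply lsum_le. intros [w' p'] Hwp.
      destruct (Hok w' p' Hwp) as (Hw & _ & _). cbn [fst snd].
      destruct (Bool.eqb_spec (prun p' x) (g x)) as [->|_]; [lra|].
      pose proof (HPsi x (prun p' x)). nra.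
  - apply lsum_le. intros [w' p'] Hwp. destruct (Hok w' p' Hwp) as (Hw & _ & _).
    specialize (Hmax _ Hwp). rewrite lsum_scal, Rmult_comm. cbn [fst snd] in *.
    fold mx in Hmax. nra.
Qed.

(** A hybrid argument: once the first gate is a fixed protocol, its output is absorbed into [Psi]
    and the other gates follow by induction. *)
Lemma fix_protocols k n r delta gs (Psi : list bool -> list bool -> R) :
  0 <= delta -> (forall x v, 0 <= Psi x v <= 1) ->
  (forall g, In g gs -> Rk_fun_le k n delta g r) ->
  exists ps, length ps = length gs /\
    (forall p, In p ps -> nof_valid k n p /\ (pcost p <= r)%nat) /\
    lsum (cube n) (fun x => Psi x (map (fun g => g x) gs)) - INR (length gs) * (delta * 2 ^ n)
    <= lsum (cube n) (fun x => Psi x (map (fun p => prun p x) ps)).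
Proof.
  intros Hd. revert Psi. induction gs as [|g gs IH]; intros Psi HPsi Hgs.
  - exists []. cbn. repeat split; try easy. lra.
  - destruct (fix_protocol k n r delta g
                (fun x b => Psi x (b :: map (fun g => g x) gs))) as (p & Hv & Hc & Hp).
    { trivial. }
    { intros; apply HPsi. }
    { apply Hgs. now left. }
    destruct (IH (fun x v => Psi x (prun p x :: v))) as (ps & Hlen & Hps & Hsum).
    { intros; apply HPsi. }
    { intros; apply Hgs. now right. }
    exists (p :: ps). cbn [length map]. rewrite S_INR. split; [now rewrite Hlen|].
    split; [|lra]. intros q [<-|Hq]; [now split|now apply Hps].
Qed.

Lemma prob_agree_lsum n f g :
  prob_agree n f g = lsum (cube n) (fun x => if Bool.eqb (f x) (g x) then 1 else 0) / 2 ^ n.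
Proof.
  unfold prob_agree. f_equal. induction (cube n) as [|x l IH]; [reflexivity|].
  rewrite lsum_cons. cbn [filter]. destruct (Bool.eqb _ _); [|lra].
  cbn [length]. rewrite S_INR. lra.
Qed.

(** Fixing the gates costs [eps / 2] in agreement and approximating the formula costs [eps / 2] in
    correlation. The surviving [eps / 2] is confronted with the cylinder bound. *)
Lemma formula_gip_correlation k m s eps (G : (list bool -> bool) -> Prop) C r T h :
  let n := (S k * m)%nat in
  0 < eps -> (1 <= n)%nat -> INR s <= INR n ^ 2 ->
  in_formula_comp n s G C ->
  prob_agree n C (gip (S k) n) >= 1 / 2 + eps ->
  Rk_class_le (S k) n (eps / (2 * INR n ^ 2)) G r ->
  260 * sqrt (INR s) <= INR T -> (1 / 4) ^ h <= eps / 4 ->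
  eps / 2 <= (1 + 2 * (2 * (((1 + 2 * INR s) * 2 ^ r) ^ T) ^ 2 + 1) ^ (2 * h)) *
             (1 - (/ 4) ^ k) ^ m.
Proof.
  intros n Heps Hn Hsn (F & gs & HFs & HFv & Hgs & HG & HC) Hagree HR HT Hh.
  assert (HnR : 1 <= INR n) by (change 1 with (INR 1); now apply le_INR).
  assert (Hn2 : 0 < INR n ^ 2) by nra.
  assert (H2n : 0 < 2 ^ n) by (apply pow_lt; lra).
  set (delta := eps / (2 * INR n ^ 2)) in *.
  assert (Hdelta : 0 < delta) by (apply Rdiv_lt_0_compat; lra).
  set (agree := fun b c : bool => if Bool.eqb b c then 1 else 0).
  set (Psi := fun x v => agree (feval (fun i => nth i v false) F) (gip (S k) n x)).
  destruct (fix_protocols (S k) n r delta gs Psi) as (ps & Hps & Hval & Hsum).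
  { lra. }
  { intros x v. unfold Psi, agree. destruct (Bool.eqb _ _); lra. }
  { intros g Hg. apply HR, HG, Hg. }
  set (f := fun x => feval (fun i => prun (nth i ps (POut false)) x) F).
  (* The defaults match, since [POut false] outputs [false]. *)
  assert (Hf : forall x, feval (fun i => nth i (map (fun p => prun p x) ps) false) F = f x).
  { intros x. unfold f. clear. induction F; cbn [feval]; rewrite ?IHF, ?IHF1, ?IHF2; trivial.
    apply (map_nth (fun p => prun p x) ps (POut false)). }
  assert (HCx : forall x, In x (cube n) ->
            feval (fun i => nth i (map (fun g => g x) gs) false) F = C x).
  { intros x Hx. rewrite HC by now apply cube_spec. clear.
    induction F; cbn [feval]; rewrite ?IHF, ?IHF1, ?IHF2; trivial.
    apply (map_nth (fun g : list bool -> bool => g x) gs (fun _ => false)). }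
  assert (Hfagree : (1 / 2 + eps / 2) * 2 ^ n <=
            lsum (cube n) (fun x => agree (f x) (gip (S k) n x))).
  { rewrite prob_agree_lsum in Hagree.
    assert (HCa : (1 / 2 + eps) * 2 ^ n <=
              lsum (cube n) (fun x => agree (C x) (gip (S k) n x))).
    { apply Rge_le, (Rmult_le_compat_r (2 ^ n)) in Hagree; [|lra].
      unfold Rdiv at 2 in Hagree. rewrite Rmult_assoc, Rinv_l, Rmult_1_r in Hagree by lra.
      exact Hagree. }
    rewrite (lsum_ext _ (fun x => Psi x (map (fun g => g x) gs))
               (fun x => agree (C x) (gip (S k) n x))) in Hsum
      by (intros x Hx; unfold Psi; now rewrite HCx).
    rewrite (lsum_ext _ (fun x => Psi x (map (fun p => prun p x) ps))
               (fun x => agree (f x) (gip (S k) n x))) in Hsum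
      by (intros x Hx; unfold Psi; now rewrite Hf).
    rewrite Hgs in Hsum.
    assert (INR s * (delta * 2 ^ n) <= eps / 2 * 2 ^ n).
    { rewrite <- Rmult_assoc. apply Rmult_le_compat_r; [lra|].
      apply Rle_trans with (INR n ^ 2 * delta); [apply Rmult_le_compat_r; lra|].
      right. unfold delta. field. lra. }
    lra. }
  set (Q := fun b : list bool -> bool => exists p, nof_valid (S k) n p /\ (pcost p <= r)%nat /\
              forall x, b x = prun p x).
  assert (Hadv : adversary Q f (fsize F)).
  { apply (adversary_formula Q s); trivial. intros i Hi. exists (nth i ps (POut false)).
    assert (Hin : In (nth i ps (POut false)) ps) by (apply nth_In; lia).
    destruct (Hval _ Hin). auto. }
  assert (HQ : forall b, Q b -> cyl_span (S k) n (2 ^ r) (fun x => sgn (b x))).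
  { intros b (p & Hv & Hc & Hb). eapply cyl_weaken; [| |apply cyl_span_proto, Hv].
    - apply Rle_pow; [lra|trivial].
    - intros x. cbn beta. now rewrite Hb. }
  pose proof (fsize_pos F) as HF0. pose proof (le_INR _ _ HFs) as HFsR.
  assert (H2r : 1 <= 2 ^ r) by (apply pow_R1_Rle; lra).
  destruct (adversary_approx_amplified (S k) n Q f (fsize F) (2 ^ r) T h (cube n))
    as (p & Hp & Happ); trivial.
  { pose proof (sqrt_le_1_alt _ _ HFsR). lra. }
  set (B := (2 * (((1 + 2 * INR s) * 2 ^ r) ^ T) ^ 2 + 1) ^ (2 * h)).
  (* Since [p] approximates the 0/1 value of [f], this function approximates its sign. *)
  assert (HB : cyl_span (S k) n (1 + 2 * B) (fun x => 1 + -2 * p x)).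
  { eapply cyl_weaken; [| |apply cyl_add;
      [apply (cyl_span_const (S k) n 1)|apply (cyl_scal (S k) n (-2)), Hp]]; [|reflexivity].
    rewrite Rabs_R1, Rabs_left by lra. apply Rplus_le_compat_l.
    replace (- -2) with 2 by lra. apply Rmult_le_compat_l; [lra|].
    pose proof (pos_INR (fsize F)) as H0.
    assert (HN0 : 0 <= (1 + 2 * INR (fsize F)) * 2 ^ r) by nra.
    assert (HNT := pow_le _ T HN0).
    apply pow_incr. split; [nra|]. apply Rplus_le_compat_r, Rmult_le_compat_l; [lra|].
    apply pow_incr. split; [trivial|]. apply pow_incr. split; [trivial|]. nra. }
  apply cyl_span_gip in HB. fold n in HB.
  set (D := (1 - (/ 4) ^ k) ^ m) in *.
  set (sg := fun x => sgn (gip (S k) n x)) in *.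
  (* The product of the two signs is [2 * agree - 1], with average at least [eps]; the error of [p]
     takes at most [2 * (1 / 4) ^ h <= eps / 2]. *)
  assert (Hlow : eps / 2 * 2 ^ n <= lsum (cube n) (fun x => sg x * (1 + -2 * p x))).
  { apply Rle_trans with (lsum (cube n) (fun x => 2 * agree (f x) (gip (S k) n x) +
                             (-1 + - (2 * (1 / 4) ^ h)))).
    - rewrite lsum_plus, lsum_scal, lsum_const, cube_length. nra.
    - apply lsum_le. intros x Hx. specialize (Happ x Hx). set (e := p x - _) in Happ.
      pose proof (Rle_abs e). pose proof (Rle_abs (- e)) as He. rewrite Rabs_Ropp in He. subst e.
      unfold sg, agree. destruct (f x), (gip (S k) n x); cbn; lra. }
  apply (Rmult_le_reg_r (2 ^ n)); [trivial|].
  eapply Rle_trans; [exact Hlow|]. eapply Rle_trans; [apply Rle_abs|].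
  eapply Rle_trans; [exact HB|]. right. fold D B. ring.
Qed.

(** * The size bound *)

Lemma nat_ceil x : 0 <= x -> exists T : nat, x <= INR T <= x + 1.
Proof.
  intros Hx. destruct (archimed x) as [H1 H2]. exists (Z.to_nat (up x)).
  rewrite INR_IZR_INZ, Z2Nat.id; [lra|]. apply le_IZR. lra.
Qed.

Lemma ln_le_self x : 0 < x -> ln x <= x - 1.
Proof.
  intros Hx. pose proof (exp_ineq1_le (ln x)) as H. rewrite exp_ln in H; lra.
Qed.

Lemma exp_mult_INR x m : exp x ^ m = exp (x * INR m).
Proof.
  rewrite <- Rpower_pow by apply exp_pos. unfold Rpower. rewrite ln_exp. f_equal. ring.
Qed.

Lemma ln2_bounds : 0 < ln 2 <= 1.
Proof.
  split; [rewrite <- ln_1; apply ln_increasing; lra|].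
  pose proof (ln_le_self 2). lra.
Qed.

Lemma ln_le_pos x y : 0 < x -> x <= y -> ln x <= ln y.
Proof.
  intros Hx [H| ->]; [left; now apply ln_increasing|lra].
Qed.

(** Logarithms of the correlation inequality, with [T] about [260 * sqrt s] and [h] about
    [log2 (1 / eps)]. The constant covers [14 * 5 * 261 + 2]. *)
Lemma formula_size_sqrt_bound k m s eps (G : (list bool -> bool) -> Prop) C r :
  let n := (S k * m)%nat in
  0 < eps -> eps < 1 / 2 -> (2 <= n)%nat -> (0 < s)%nat -> INR s <= INR n ^ 2 ->
  in_formula_comp n s G C ->
  prob_agree n C (gip (S k) n) >= 1 / 2 + eps ->
  Rk_class_le (S k) n (eps / (2 * INR n ^ 2)) G r ->
  (/ 4) ^ k * INR m <= 20000 * sqrt (INR s) * (INR r + log2 (INR n)) * log2 (1 / eps).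
Proof.
  intros n He0 He1 Hn Hs Hsn HC Hag HR.
  pose proof ln2_bounds as Hl2.
  assert (HnR : 2 <= INR n) by (change 2 with (INR 2); now apply le_INR).
  assert (HsR : 1 <= INR s) by (change 1 with (INR 1); apply le_INR; lia).
  set (W := sqrt (INR s)).
  assert (HW : 1 <= W) by (unfold W; rewrite <- sqrt_1; now apply sqrt_le_1_alt).
  set (Lg := log2 (1 / eps)). set (q := INR r + log2 (INR n)).
  assert (HLg : Lg * ln 2 = ln (1 / eps)) by (unfold Lg, log2; field; lra).
  assert (Hinv : 2 < 1 / eps).
  { apply (Rmult_lt_reg_r eps); [lra|]. field_simplify; lra. }
  assert (HLg1 : 1 <= Lg).
  { apply (Rmult_le_reg_r (ln 2)); [lra|]. rewrite HLg, Rmult_1_l. apply ln_le_pos; lra. }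
  assert (Hlogn : log2 (INR n) * ln 2 = ln (INR n)) by (unfold log2; field; lra).
  assert (Hlogn1 : 1 <= log2 (INR n)).
  { apply (Rmult_le_reg_r (ln 2)); [lra|]. rewrite Hlogn, Rmult_1_l. apply ln_le_pos; lra. }
  assert (Hq : 1 <= q) by (unfold q; pose proof (pos_INR r); lra).
  destruct (nat_ceil (260 * W)) as (T & HT1 & HT2); [lra|].
  destruct (nat_ceil (Lg + 1)) as (h & Hh1 & Hh2); [lra|].
  assert (Hh : (1 / 4) ^ h <= eps / 4).
  { apply Rnot_lt_le. intros Hlt.
    apply ln_increasing in Hlt; [|lra]. rewrite ln_pow in Hlt by lra.
    replace (1 / 4) with (/ (2 ^ 2)) in Hlt by field.
    replace (eps / 4) with (/ (1 / eps * 2 ^ 2)) in Hlt by (field; lra).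
    rewrite !ln_Rinv, ln_mult, ln_pow, <- HLg in Hlt by lra.
    change (INR 2) with 2 in Hlt. nra. }
  pose proof (formula_gip_correlation k m s eps G C r T h He0 ltac:(fold n; lia) Hsn HC Hag HR
                HT1 Hh) as Hmain.
  set (N := (1 + 2 * INR s) * 2 ^ r) in Hmain. set (M := N ^ T) in Hmain.
  assert (H2r : 1 <= 2 ^ r) by (apply pow_R1_Rle; lra).
  assert (HN : 1 <= N) by (unfold N; nra).
  assert (HM : 1 <= M) by (apply pow_R1_Rle; lra).
  assert (HTR : 1 <= INR T) by lra.
  (* For [s <= n ^ 2] and [n >= 2] one has [1 + 2 * s <= n ^ 4]. *)
  assert (HlnN : ln N <= 4 * ln 2 * q).
  { unfold N. rewrite ln_mult, ln_pow by lra.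
    assert (Hs4 : ln (1 + 2 * INR s) <= INR 4 * ln (INR n)).
    { rewrite <- ln_pow by lra. apply ln_le_pos; [lra|].
      assert (4 <= INR n ^ 2) by nra. replace (INR n ^ 4) with (INR n ^ 2 * INR n ^ 2) by ring.
      nra. }
    change (INR 4) with (2 + 1 + 1) in Hs4. unfold q. pose proof (pos_INR r). nra. }
  assert (HlnM : ln M <= INR T * (4 * ln 2 * q)).
  { unfold M. rewrite ln_pow by lra. apply Rmult_le_compat_l; lra. }
  (* A single power is convenient for logarithms: [2 * M ^ 2 + 1 <= (2 * M) ^ 2], and a further
     [(2 * M) ^ 2 >= 4] absorbs the outer [1 + 2]. *)
  assert (HB : 1 + 2 * (2 * M ^ 2 + 1) ^ (2 * h) <= (2 * M) ^ (2 * (2 * h) + 2)).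
  { rewrite pow_add, (pow_mult (2 * M) 2). assert (HM2 : 1 <= M ^ 2) by nra.
    assert (H1 : 1 <= (2 * M ^ 2 + 1) ^ (2 * h)) by (apply pow_R1_Rle; lra).
    assert (H2 : (2 * M ^ 2 + 1) ^ (2 * h) <= ((2 * M) ^ 2) ^ (2 * h)) by (apply pow_incr; nra).
    assert (H3 : 4 <= (2 * M) ^ 2) by nra.
    set (Y := _ ^ (2 * h)) in *. set (Z := _ ^ (2 * h)) in *. nra. }
  set (p := (/ 4) ^ k).
  assert (Hp : 0 < p <= 1).
  { split; [apply pow_lt; lra|]. unfold p. rewrite <- (pow1 k). apply pow_incr. lra. }
  assert (Hexp : (1 - p) ^ m <= exp (- (p * INR m))).
  { replace (exp (- (p * INR m))) with (exp (- p) ^ m)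
      by (rewrite exp_mult_INR; f_equal; ring).
    apply pow_incr. pose proof (exp_ineq1_le (- p)). lra. }
  assert (Hfin : eps / 2 <= (2 * M) ^ (2 * (2 * h) + 2) * exp (- (p * INR m))).
  { eapply Rle_trans; [exact Hmain|]. fold p. apply Rmult_le_compat; trivial.
    - assert (1 <= (2 * M ^ 2 + 1) ^ (2 * h)) by (apply pow_R1_Rle; nra). lra.
    - apply pow_le. lra. }
  apply ln_le_pos in Hfin; [|lra].
  assert (HM2 : 0 < (2 * M) ^ (2 * (2 * h) + 2)) by (apply pow_lt; lra).
  rewrite ln_mult, ln_exp, ln_pow, ln_mult in Hfin by (trivial; lra || apply exp_pos).
  replace (eps / 2) with (/ (1 / eps * 2)) in Hfin by (field; lra).
  rewrite ln_Rinv, ln_mult, <- HLg in Hfin by lra.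
  rewrite plus_INR, !mult_INR in Hfin. change (INR 2) with 2 in Hfin.
  assert (HTq : 1 <= INR T * q) by nra.
  assert (H1 : ln 2 + ln M <= 5 * (INR T * q)) by nra.
  assert (H2 : (2 * (2 * INR h) + 2) * (ln 2 + ln M) <= 14 * Lg * (5 * (INR T * q))).
  { apply Rmult_le_compat; try lra. assert (0 <= ln M); [|lra].
    rewrite <- ln_1. apply ln_le_pos; lra. }
  assert (H3 : INR T * q <= 261 * W * q) by (apply Rmult_le_compat_r; lra).
  assert (H4 : 14 * Lg * (5 * (INR T * q)) <= 14 * Lg * (5 * (261 * W * q)))
    by (apply Rmult_le_compat_l; lra).
  assert (H5 : Lg * ln 2 + ln 2 <= 2 * Lg) by nra.
  assert (HWq : 1 <= W * q) by nra.
  assert (H6 : 2 * Lg <= 2 * Lg * (W * q)) by nra.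
  lra.
Qed.

Theorem theorem3p1 :
  exists c : R, 0 < c /\
  forall (k n s : nat) (eps : R) (G : (list bool -> bool) -> Prop)
         (C : list bool -> bool) (r : nat),
    (2 <= k)%nat -> Nat.divide k n -> (0 < s)%nat ->
    0 < eps -> eps < 1 / 2 ->
    in_formula_comp n s G C ->
    prob_agree n C (gip k n) >= 1 / 2 + eps ->
    Rk_class_eq k n (eps / (2 * INR n ^ 2)) G r ->
    INR s >= c * INR n ^ 2 /
             (INR k ^ 2 * 16 ^ k * (INR r + log2 (INR n)) ^ 2
              * (log2 (1 / eps)) ^ 2).
Proof.
  (* This is [16 / 20000 ^ 2]; the 16 is what remains of [16 ^ S k] against the square of
     [(/ 4) ^ k]. *)
  exists (/ 25000000). split; [lra|].
  intros k n s eps G C r Hk [m Hm] Hs He0 He1 HC Hag [HR _].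
  destruct k as [|k]; [lia|]. rewrite Nat.mul_comm in Hm.
  assert (HsR : 1 <= INR s) by (change 1 with (INR 1); apply le_INR; lia).
  destruct m as [|m].
  (* Empty blocks make [n = 0], and the lower bound is 0. *)
  { replace n with O by lia. unfold Rdiv. cbn [INR pow]. lra. }
  assert (Hn : (2 <= n)%nat) by nia.
  pose proof ln2_bounds as Hl2.
  assert (HnR : 2 <= INR n) by (change 2 with (INR 2); now apply le_INR).
  assert (HkR : 2 <= INR (S k)) by (change 2 with (INR 2); now apply le_INR).
  set (Lg := log2 (1 / eps)). set (q := INR r + log2 (INR n)).
  assert (HLg : 1 <= Lg).
  { unfold Lg, log2. apply (Rmult_le_reg_r (ln 2)); [lra|].
    unfold Rdiv at 1. rewrite Rmult_assoc, Rinv_l, Rmult_1_l, Rmult_1_r by lra.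
    apply ln_le_pos; [lra|]. apply (Rmult_le_reg_r eps); [lra|]. field_simplify; lra. }
  assert (Hq : 1 <= q).
  { assert (1 <= log2 (INR n)); [|unfold q; pose proof (pos_INR r); lra].
    unfold log2. apply (Rmult_le_reg_r (ln 2)); [lra|].
    unfold Rdiv. rewrite Rmult_assoc, Rinv_l, Rmult_1_l, Rmult_1_r by lra.
    apply ln_le_pos; lra. }
  assert (H16 : 1 <= 16 ^ S k) by (apply pow_R1_Rle; lra).
  set (X := INR (S k) ^ 2 * 16 ^ S k). assert (HX : 1 <= X) by (unfold X; nra).
  assert (HXq : 1 <= X * q ^ 2 * Lg ^ 2).
  { assert (Hq2 : 1 <= q ^ 2) by now apply pow_R1_Rle.
    assert (HL2 : 1 <= Lg ^ 2) by now apply pow_R1_Rle.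
    rewrite <- (Rmult_1_r 1). apply Rmult_le_compat; try lra.
    rewrite <- (Rmult_1_r 1). apply Rmult_le_compat; lra. }
  apply Rle_ge, (Rmult_le_reg_r (X * q ^ 2 * Lg ^ 2)); [lra|].
  unfold Rdiv. rewrite Rmult_assoc, Rinv_l, Rmult_1_r by lra.
  (* For [s > n ^ 2] the claim is immediate, the denominator being at least 1. *)
  destruct (Rle_dec (INR s) (INR n ^ 2)) as [Hsn|Hsn];
    [|apply Rnot_le_lt in Hsn; apply Rle_trans with (INR s * 1); [nra|apply Rmult_le_compat_l; lra]].
  subst n.
  pose proof (formula_size_sqrt_bound k (S m) s eps G C r He0 He1 Hn Hs Hsn HC Hag HR) as H.
  fold q Lg in H. set (W := sqrt (INR s)) in H.
  assert (HW2 : W ^ 2 = INR s) by (apply pow2_sqrt; lra).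
  rewrite mult_INR. set (K := INR (S k)) in *. set (m' := INR (S m)) in *.
  assert (H2 : ((/ 4) ^ k * m') ^ 2 <= (20000 * W * q * Lg) ^ 2).
  { apply pow_incr. split; [|trivial]. apply Rmult_le_pos; [apply pow_le; lra|apply pos_INR]. }
  assert (E : 16 ^ S k * ((/ 4) ^ k) ^ 2 = 16).
  { rewrite <- pow_mult, (Nat.mul_comm k 2), pow_mult. cbn [pow].
    rewrite Rmult_assoc, <- Rpow_mult_distr.
    replace (16 * (/ 4 * (/ 4 * 1))) with 1 by field. rewrite pow1. ring. }
  rewrite <- HW2. unfold X.
  apply Rle_trans with (/ 400000000 * (K ^ 2 * (16 ^ S k * ((/ 4) ^ k) ^ 2) * m' ^ 2)).
  { rewrite E. right. field. }
  apply Rle_trans with (/ 400000000 * (K ^ 2 * 16 ^ S k * (20000 * W * q * Lg) ^ 2)).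
  - apply Rmult_le_compat_l; [lra|].
    replace (K ^ 2 * (16 ^ S k * ((/ 4) ^ k) ^ 2) * m' ^ 2)
      with (K ^ 2 * 16 ^ S k * ((/ 4) ^ k * m') ^ 2) by ring.
    apply Rmult_le_compat_l; [|trivial]. fold X. lra.
  - right. field.
Qed.
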